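(* An abelian group $G$ has finite torsion-free rank and bounded $p$-torsion if, and only if, it decomposes as $G=H\oplus S$, where $H$ is a Bassian group and $S$ is a torsion group with bounded $p$-torsion.
   Context: All groups are abelian. The torsion-free rank of $G$ is $r_0(G)=\dim_{\mathbb Q}(G\otimes\mathbb Q)$. For a group $G$, $T$ is its maximal torsion subgroup and $T_p$ is the $p$-primary component of $T$. $G$ has bounded $p$-torsion if for every prime $p$ the group $T_p$ is bounded (i.e., $p^{n}T_p=0$ for some $n$ depending on $p$). A group $G$ is Bassian if, for every subgroup $N$ of $G$, the existence of an injective homomorphism $G\to G/N$ implies that $N=\{0\}$. *)

(* Defs.v *)
From HB Require Import structures.
From mathcomp Require Import all_boot all_order all_algebra.

Set Implicit Arguments.
Unset Strict Implicit.
Unset Printing Implicit Defensive.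

Import GRing.Theory.
Local Open Scope ring_scope.

(* Abelian groups are zmodTypes and subgroups of G are terms of                *)
(* [zmodClosed G].  Membership is boolean; in classical logic every subgroup   *)
(* arises in this way.                                                         *)

(* The subgroup A, as a group in its own right. *)
Definition subgroup (G : zmodType) (A : zmodClosed G) := {x : G | x \in A}.

HB.instance Definition _ (G : zmodType) (A : zmodClosed G) :=
  SubChoice.on (subgroup A).
HB.instance Definition _ (G : zmodType) (A : zmodClosed G) :=
  [SubChoice_isSubZmodule of subgroup A by <:].

Definition biadditive (A B C : zmodType) (b : A -> B -> C) : Prop :=
  (forall x x' y, b (x + x') y = b x y + b x' y) /\
  (forall x y y', b x (y + y') = b x y + b x y').

(* Universal property of the tensor product V of G and the rationals over the *)
(* integers, t x q being the pure tensor of x and q; scalars act on the        *)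
(* rational factor.                                                            *)
Definition is_rational_tensor (G : zmodType) (V : lmodType rat)
    (t : G -> rat -> V) : Prop :=
  [/\ biadditive t,
      forall (W : zmodType) (b : G -> rat -> W), biadditive b ->
        exists f : {additive V -> W},
          (forall x q, f (t x q) = b x q) /\
          (forall f' : {additive V -> W},
             (forall x q, f' (t x q) = b x q) -> f' =1 f)
    & forall (a : rat) x q, a *: t x q = t x (a * q)].

Definition has_torsion_free_rank (G : zmodType) (n : nat) : Prop :=
  exists (V : vectType rat) (t : G -> rat -> V),
    is_rational_tensor t /\ \dim (fullv : {vspace V}) = n.

Definition finite_torsion_free_rank (G : zmodType) : Prop :=
  exists n : nat, has_torsion_free_rank G n.

(* Membership in the maximal torsion subgroup T of G. *)
Definition in_torsion (G : zmodType) (x : G) : Prop :=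
  exists2 n : nat, (0 < n)%N & x *+ n = 0.

(* Membership in the p-primary component T_p of T. *)
Definition in_primary_torsion (G : zmodType) (p : nat) (x : G) : Prop :=
  in_torsion x /\ exists k : nat, x *+ (p ^ k) = 0.

Definition torsion_group (G : zmodType) : Prop := forall x : G, in_torsion x.

Definition bounded_p_torsion (G : zmodType) : Prop :=
  forall p : nat, prime p ->
    exists n : nat, forall x : G, in_primary_torsion p x -> x *+ (p ^ n) = 0.

Definition Bassian (G : zmodType) : Prop :=
  forall N : zmodClosed G,
    (exists f : {additive G -> Quotient.quot N}, injective f) ->
    forall x : G, x \in N -> x = 0.

Definition internal_direct_sum (G : zmodType) (A B : zmodClosed G) : Prop :=
  (forall x : G, exists2 a, a \in A & exists2 b, b \in B & x = a + b) /\
  (forall x : G, x \in A -> x \in B -> x = 0).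

(* Main.v *)
Require Import Defs.
From HB Require Import structures.
From mathcomp Require Import all_boot all_order all_algebra.
From mathcomp Require Import boolp.
From mathcomp Require classical_sets.

(** Call a family of elements of [G] a rational basis when it becomes a basis
    after tensoring with the rationals; the torsion-free rank is finite exactly
    when a finite rational basis exists.  Two tools serve throughout: Baer's
    extension of partial homomorphisms ([Baer_extension]) and maximal subgroups
    given by Zorn's lemma ([maximal_subgroup]).

    A Bassian group [G] has finite torsion-free rank and bounded primary
    components.  Suppose that a subgroup [A] of [G] maps onto a divisible group
    [D], with a nonzero kernel [K], and also embeds into [D].  Because [D] is
    divisible, the embedding of [A] into [D = A/K] can be spread to an embedding
    of [G] into [G/K], and [G] is not Bassian ([Bassian_obstruction]).  Infinite
    rank provides such an [A], free of countable rank, with [D] a rational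
    vector space ([Bassian_rational_basis]).  An unbounded [T_p] provides one
    too: either some [p^m T_p] is divisible and nonzero, and multiplication by
    [p] maps it onto itself, or [T_p] contains a direct sum of cyclic groups
    whose orders can be prescribed to be large enough for a map onto a direct
    sum of quasicyclic groups ([Bassian_bounded]).  Adding a torsion group [S]
    with bounded primary components does not affect these two conclusions.

    Conversely, a group with finite rank and finite primary components is
    Bassian, by counting ([Bassian_of_finite]).  So, given [G] of finite rank
    with bounded [T_p], it suffices to split off, for all primes at once, a
    cofinite part of each [T_p].  Fix a rational basis and let [F] be its span.
    For each [p] there is a projection of [G] onto a subgroup of [T_p] that
    vanishes on [F] and has a finite kernel on [T_p] ([cofinite_retraction]).
    Since [G/F] is torsion, only finitely many of these projections are nonzero
    on a given element, and they can be added: the sum projects [G] onto [S],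
    with kernel [H] ([split_retractions]).

    The projection for [p] is built by descending induction on the exponent.
    With [q = p^(k+1)], a subgroup that is a direct sum of copies of [Z/q] is
    injective over [Z/q], hence is a direct summand of [G] as soon as it meets
    [q G] trivially; replacing [q G] by a larger subgroup containing [F] makes
    the projection vanish on [F].  A maximal such subgroup leaves in [T_p] only
    elements whose multiples by [p^k] lie in the larger subgroup, and these
    multiples are finite in number because [F] is finitely generated
    ([finite_residual_step]). *)

Set Implicit Arguments.
Unset Strict Implicit.
Unset Printing Implicit Defensive.

Import GRing.Theory Num.Theory.
Local Open Scope ring_scope.

(** * Subgroups, and maximal subgroups with a monotone property *)

Definition is_subgroup (G : zmodType) (A : G -> Prop) : Prop :=
  A 0 /\ forall x y, A x -> A y -> A (x - y).

Section SubgroupTheory.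
Variables (G : zmodType) (A : G -> Prop).
Hypothesis subA : is_subgroup A.

Lemma is_subgroupN x : A x -> A (- x).
Proof. by move=> Ax; rewrite -sub0r; apply: subA.2 => //; exact: subA.1. Qed.

Lemma is_subgroupD x y : A x -> A y -> A (x + y).
Proof.
by move=> Ax Ay; rewrite -[y]opprK; apply: subA.2 => //; exact: is_subgroupN.
Qed.

Lemma is_subgroupMn x n : A x -> A (x *+ n).
Proof.
move=> Ax; elim: n => [|n IH]; first exact: subA.1.
by rewrite mulrS; exact: is_subgroupD.
Qed.

Lemma is_subgroupMz x (z : int) : A x -> A (x *~ z).
Proof.
by case: z => n Ax; rewrite ?NegzE ?mulrNz; [|apply: is_subgroupN];
  exact: is_subgroupMn.
Qed.

Lemma zmodClosed_of_is_subgroup :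
  exists N : zmodClosed G, forall x, x \in N <-> A x.
Proof.
pose S : {pred G} := fun x => `[< A x >].
have clA : zmod_closed S.
  split=> [|x y]; rewrite /S !unfold_in; first by apply/asboolP; exact: subA.1.
  by move=> /asboolP Ax /asboolP Ay; apply/asboolP; exact: subA.2.
pose N : zmodClosed G :=
  HB.pack S (GRing.isZmodClosed.Build G S clA).
by exists N => x; rewrite unfold_in; split => /asboolP.
Qed.

End SubgroupTheory.

(** Zorn's lemma is applied to the sets whose union with [A0] satisfies [P], so
    that the empty chain, whose union is [A0], needs no assumption of its own. *)
Lemma maximal_above (T : Type) (P : (T -> Prop) -> Prop) (A0 : T -> Prop) :
  P A0 ->
  (forall F : (T -> Prop) -> Prop,
     (exists A, F A) -> (forall A, F A -> P A) ->
     (forall A B, F A -> F B ->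
        (forall x, A x -> B x) \/ (forall x, B x -> A x)) ->
     P (fun x => exists2 A, F A & A x)) ->
  exists A, [/\ P A, forall x, A0 x -> A x &
    forall B, P B -> (forall x, A x -> B x) -> forall x, B x -> A x].
Proof.
move=> PA0 chainP.
pose U (X : T -> Prop) x := X x \/ A0 x.
have [|A [PA maxA]] := @classical_sets.Zorn_bigcup T (fun X => P (U X)).
  move=> F FP totF; have [[X0 FX0]|noF] := pselect (exists X, F X); last first.
    rewrite (_ : U _ = A0) //; apply/predeqP => x; split; last by right.
    by case=> // -[X FX]; case: noF; exists X.
  rewrite (_ : U _ = fun x => exists2 B, (exists2 X, F X & B = U X) & B x).
    apply: chainP; first by exists (U X0), X0.
      by move=> _ [X FX ->]; exact: FP.
    move=> _ _ [X FX ->] [Y FY ->].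
    by case: (totF X Y FX FY) => sub; [left|right] => x -[/sub|]; by [left|right].
  apply/predeqP => x; split=> [[[X FX Xx]|A0x]|[_ [X FX ->] [Xx|A0x]]].
  - by exists (U X); [exists X|left].
  - by exists (U X0); [exists X0|right].
  - by left; exists X.
  - by right.
exists (U A); split=> //; first by right.
move=> B PB AB x Bx; apply: contrapT => nAx.
apply: (maxA B); last first.
  rewrite (_ : U B = B) //; apply/predeqP => y; split; last by left.
  by case=> // A0y; apply: AB; right.
split=> [y Ay|/(_ x Bx) Ax]; first by apply: AB; left.
by apply: nAx; left.
Qed.

(** A property of the form below survives unions of nonempty chains of
    subgroups because each instance of it concerns a single element. *)
Lemma maximal_subgroup (G : zmodType) (Q : (G -> Prop) -> G -> Prop)
    (A0 : G -> Prop) :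
  (forall A B x, (forall y, A y -> B y) -> Q A x -> Q B x) ->
  is_subgroup A0 -> (forall x, A0 x -> Q A0 x) ->
  exists A, [/\ is_subgroup A, forall x, A x -> Q A x, forall x, A0 x -> A x &
    forall B, is_subgroup B -> (forall x, B x -> Q B x) ->
      (forall x, A x -> B x) -> forall x, B x -> A x].
Proof.
move=> monQ subA0 QA0.
have [||A [[subA QA] A0A maxA]] := @maximal_above G
    (fun A => is_subgroup A /\ forall x, A x -> Q A x) A0; first by [].
  move=> F [X0 FX0] FP totF; split; last first.
    move=> x [X FX Xx]; apply: (monQ X); first by move=> y Xy; exists X.
    by case: (FP X FX) => _; exact.
  split; first by exists X0 => //; case: (FP X0 FX0) => -[].
  move=> x y [X FX Xx] [Y FY Yy].
  case: (totF X Y FX FY) => sub; [exists Y|exists X] => //.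
    by case: (FP Y FY) => -[_ subY] _; apply: subY => //; exact: sub.
  by case: (FP X FX) => -[_ subX] _; apply: subX => //; exact: sub.
by exists A; split=> // B subB QB; exact: maxA.
Qed.

(** * Homomorphisms as graphs, and Baer's extension theorem *)

Lemma pair_mulrn (G D : zmodType) (x : G) (y : D) n :
  (x, y) *+ n = (x *+ n, y *+ n).
Proof. by elim: n => // n IH; rewrite !mulrS IH. Qed.

Lemma pair_mulrz (G D : zmodType) (x : G) (y : D) (z : int) :
  (x, y) *~ z = (x *~ z, y *~ z).
Proof. by case: z => n; rewrite ?NegzE ?mulrNz -!pmulrn pair_mulrn. Qed.

Lemma additive_of_morphism (G D : zmodType) (f : G -> D) :
  zmod_morphism f -> exists F : {additive G -> D}, forall x, F x = f x.
Proof.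
move=> addf; pose F : {additive G -> D} :=
  HB.pack f (GRing.isZmodMorphism.Build G D f addf).
by exists F.
Qed.

Lemma additive_of_graph (G D : zmodType) (R : G * D -> Prop) :
  is_subgroup R -> (forall d, R (0, d) -> d = 0) ->
  (forall g, exists d, R (g, d)) ->
  exists f : {additive G -> D}, forall g d, R (g, d) <-> f g = d.
Proof.
move=> subR R0 totR; have [f Rf] := choice totR.
have uniqR g d : R (g, d) -> f g = d.
  move=> Rgd; apply/eqP; rewrite -subr_eq0; apply/eqP/R0.
  by rewrite -(subrr g); exact: (subR.2 _ _ (Rf g) Rgd).
have [|F FE] := @additive_of_morphism G D f.
  by move=> x y; apply: uniqR; exact: (subR.2 _ _ (Rf x) (Rf y)).
by exists F => g d; rewrite FE; split=> [/uniqR//|<-]; exact: Rf.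
Qed.

(** Baer's criterion relative to a partial homomorphism, given by its graph
    [R0].  If [R0] maps [g *+ (n * m)] to 0, then every extension that sends
    [g *+ n] to [d] satisfies [d *+ m = 0]; divisibility by [n] is asked only of
    the [d] that pass this test.  It holds when [D] is divisible, and also when
    [D] is a self-injective module over the integers modulo [q] and [R0] vanishes
    on the multiples of [q]. *)
Lemma Baer_extension (G D : zmodType) (R0 : G * D -> Prop) :
  is_subgroup R0 -> (forall d, R0 (0, d) -> d = 0) ->
  (forall (g : G) (n : nat) (d : D), (0 < n)%N ->
     (forall m, R0 (g *+ (n * m), 0) -> d *+ m = 0) ->
     exists d', d' *+ n = d) ->
  exists f : {additive G -> D}, forall g d, R0 (g, d) -> f g = d.
Proof.
move=> subR0 funR0 divD.
have [|||R [subR QR R0R maxR]] := @maximal_subgroup (G * D)%type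
  (fun _ x => x.1 = 0 -> x.2 = 0) R0; [by []|by []| |].
  by move=> [g d] /= Rgd g0; apply: funR0; rewrite -g0.
have funR d : R (0, d) -> d = 0 by move=> /QR; exact.
suff totR g : exists d, R (g, d).
  have [f Rf] := additive_of_graph subR funR totR.
  by exists f => g d /R0R/Rf.
(* The order of [g] modulo the domain of [R] governs the choice of an image. *)
have [d' Hd'] : exists d' : D, forall (z : int) d, R (g *~ z, d) -> d' *~ z = d.
  have [/asboolP|none] := boolP `[< exists n, (0 < n)%N &&
      `[< exists d, R (g *+ n, d) >] >]; last first.
    exists 0 => z d Rzd; have [z0|z_neq0] := eqVneq z 0.
      by move: Rzd; rewrite z0 !mulr0z => /funR ->.
    case/asboolP: none; exists `|z|%N; rewrite absz_gt0 z_neq0; apply/asboolP.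
    case: z Rzd {z_neq0} => k Rzd; first by exists d.
    by exists (- d); rewrite -[_ *+ _]opprK; exact: (is_subgroupN subR Rzd).
  case/ex_minnP => n /andP[n_gt0 /asboolP[d0 Rd0]] min_n.
  have [|d' d'E] := divD g n d0 n_gt0.
    move=> m /R0R R_0; apply: funR.
    have := subR.2 _ _ (is_subgroupMn subR m Rd0) R_0.
    by rewrite pair_mulrn -mulrnA -[X in R X]/(_ - _, _ - _) subrr subr0.
  exists d' => z d Rzd; have n_neq0 : n%:Z != 0 by rewrite -lt0n.
  have Rmod : R (g *~ (z %% n)%Z, d - d0 *~ (z %/ n)%Z).
    have := subR.2 _ _ Rzd (is_subgroupMz subR (z %/ n)%Z Rd0).
    rewrite pair_mulrz -[X in R X]/(_ - _, _ - _) pmulrn -mulrzA -mulrzBr.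
    rewrite (_ : z - n%:Z * (z %/ n)%Z = (z %% n)%Z) //.
    by rewrite {1}(divz_eq z n) mulrC addrC addKr.
  have mod_lt : (`|(z %% n)%Z| < n)%N.
    by rewrite -ltz_nat abszE ger0_norm ?modz_ge0 ?ltz_pmod.
  have mod0 : (z %% n)%Z = 0.
    apply/eqP; rewrite -absz_eq0 -leqn0 leqNgt; apply/negP => mod_gt0.
    move: mod_lt; rewrite ltnNge min_n // mod_gt0; apply/asboolP.
    by exists (d - d0 *~ (z %/ n)%Z); rewrite pmulrn abszE ger0_norm ?modz_ge0.
  move: Rmod; rewrite mod0 mulr0z => /funR/eqP; rewrite subr_eq0 => /eqP ->.
  by rewrite {1}(divz_eq z n) mod0 addr0 -d'E pmulrn -mulrzA mulrC.
pose R' (x : G * D) := exists2 y, R y & exists z : int, x = y + (g, d') *~ z.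
exists d'; apply: (maxR R').
- split; first by exists 0; [exact: subR.1|exists 0; rewrite mulr0z addr0].
  move=> _ _ [x Rx [z ->]] [y Ry [t ->]]; exists (x - y); first exact: subR.2.
  by exists (z - t); rewrite mulrzBr opprD addrACA.
- move=> _ [[a b] Rab [z ->]]; rewrite pair_mulrz /= => /eqP.
  rewrite addr_eq0 => /eqP aE; rewrite aE -mulrNz in Rab.
  by rewrite -(Hd' _ _ Rab) mulrNz addNr.
- by move=> x Rx; exists x => //; exists 0; rewrite mulr0z addr0.
- by exists 0; [exact: subR.1|exists 1; rewrite mulr1z add0r].
Qed.

(** * How a Bassian group is forced to be small *)

Definition divisible (D : zmodType) : Prop :=
  forall (n : nat) (d : D), (0 < n)%N -> exists d', d' *+ n = d.

Lemma quotient_map (G : zmodType) (N : zmodClosed G) :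
  exists q : {additive G -> Quotient.quot N},
    (forall x, q x = 0 <-> x \in N) /\ (forall y, exists x, q x = y).
Proof.
have [|q qE] := @additive_of_morphism G (Quotient.quot N)
    (fun x => \pi_(Quotient.quot N)%qT x).
  by move=> x y; rewrite !piE.
exists q; split=> [x|y]; last by exists (repr y); rewrite qE reprK.
have -> : x \in N = (q x == q 0).
  by rewrite !qE -[x in LHS]subr0 Quotient.idealrBE.
by rewrite raddf0; split => /eqP.
Qed.

(** With [A] the image of [e] and [K] that of the kernel of [sigma], the
    quotient [A/K] is the divisible group [D], which also receives [A]
    injectively through [tau].  The difference between the two maps from [A] to
    [D] extends to [psi : G -> D]; adding [psi] to the projection of [G] onto
    [G/K] does not change an element modulo [A/K], and on [A] the sum is the
    injection given by [tau], so the sum embeds [G] into [G/K]. *)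
Lemma Bassian_obstruction (G P D : zmodType)
    (e : {additive P -> G}) (sigma tau : {additive P -> D}) :
  divisible D -> (forall d, exists u, sigma u = d) ->
  (forall u, e u = 0 -> sigma u = 0) -> (forall u, e u = 0 <-> tau u = 0) ->
  Bassian G -> forall u, sigma u = 0 -> e u = 0.
Proof.
move=> divD sigma_onto ker_e_sigma ker_e_tau BG u sigma_u.
have [|N NE] := @zmodClosed_of_is_subgroup G
    (fun x => exists2 v, sigma v = 0 & e v = x).
  split; first by exists 0; rewrite raddf0.
  by move=> _ _ [v v0 <-] [w w0 <-]; exists (v - w); rewrite raddfB // v0 w0 subr0.
have [q [qE _]] := quotient_map N.
have [|||psi psiE] := @Baer_extension G D
    (fun x => exists v, x = (e v, tau v - sigma v)).
- split; first by exists 0; rewrite (raddf0 e) (raddf0 tau) (raddf0 sigma) subr0.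
  move=> _ _ [v ->] [w ->]; exists (v - w).
  by rewrite !raddfB -[LHS]/(_ - _, _ - _) addrACA -opprD.
- move=> d [v [/esym ev ->]].
  by rewrite (proj1 (ker_e_tau v) ev) (ker_e_sigma v ev) subr0.
- by move=> g n d n_gt0 _; exact: divD.
have [|||j jE] := @additive_of_graph D (Quotient.quot N)
    (fun x => exists v, x = (sigma v, q (e v))).
- split; first by exists 0; rewrite !raddf0.
  by move=> _ _ [v ->] [w ->]; exists (v - w); rewrite !raddfB.
- by move=> d [v [/esym v0 ->]]; apply/qE/NE; exists v.
- by move=> d; have [v <-] := sigma_onto d; exists (q (e v)), v.
have jsigma v : j (sigma v) = q (e v) by apply/jE; exists v.
have psie v : psi (e v) = tau v - sigma v by apply: psiE; exists v.
have j_inj d : j d = 0 -> d = 0.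
  have [v <-] := sigma_onto d; rewrite jsigma => /qE/NE [w w0 ew].
  suff: sigma (v - w) = 0 by rewrite raddfB w0 subr0.
  by apply: ker_e_sigma; rewrite raddfB ew subrr.
have [|F FE] := @additive_of_morphism _ _ (fun g => q g + j (psi g)).
  by move=> x y; rewrite !raddfB opprD addrACA.
apply: (BG N); last by apply/NE; exists u.
exists F; apply: raddf_inj => g; rewrite FE => fg0.
have [v vE] := sigma_onto (- psi g).
have [w w0 ew] : exists2 w, sigma w = 0 & e w = g - e v.
  by apply/NE/qE; rewrite raddfB -jsigma vE raddfN opprK.
have gE : g = e (w + v) by rewrite raddfD ew subrK.
move: fg0; rewrite gE psie -jsigma -raddfD addrC subrK => /j_inj.
by move/ker_e_tau.
Qed.

(** * Integral spans and rational bases *)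

Fixpoint zspan (G : zmodType) (l : seq G) (x : G) : Prop :=
  if l is y :: l' then exists z : int, zspan l' (x - y *~ z) else x = 0.

Fixpoint indep (G : zmodType) (l : seq G) : Prop :=
  if l is y :: l' then
    indep l' /\ forall z : int, zspan l' (y *~ z) -> z = 0
  else True.

(** A maximal independent family, that is, a family of elements of [G] whose
    images form a basis of the tensor product of [G] with the rationals. *)
Definition rational_basis (G : zmodType) (l : seq G) : Prop :=
  indep l /\ forall g, exists2 n, (0 < n)%N & zspan l (g *+ n).

Section SpanTheory.
Variable G : zmodType.
Implicit Types (l : seq G) (x y : G).

Lemma zspan_subgroup l : is_subgroup (zspan l).
Proof.
elim: l => [|y l [IH0 IHB]] /=; first by split=> // x y -> ->; rewrite subr0.
split; first by exists 0; rewrite mulr0z subr0.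
move=> x x' [z Hz] [z' Hz']; exists (z - z').
rewrite (_ : _ - _ = (x - y *~ z) - (x' - y *~ z')); first exact: IHB.
by rewrite mulrzBr !opprB addrACA [RHS]addrACA [- (y *~ z) - _]addrC.
Qed.

Lemma zspan_cons y l x : zspan l x -> zspan (y :: l) x.
Proof. by exists 0; rewrite mulr0z subr0. Qed.

Lemma zspan_head y l : zspan (y :: l) y.
Proof. by exists 1; rewrite mulr1z subrr; case: (zspan_subgroup l). Qed.

Lemma mem_zspan l x : x \in l -> zspan l x.
Proof.
elim: l => // y l IH; rewrite inE => /predU1P[->|/IH]; first exact: zspan_head.
exact: zspan_cons.
Qed.

Lemma zspan_min (A : G -> Prop) l x :
  is_subgroup A -> (forall y, y \in l -> A y) -> zspan l x -> A x.
Proof.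
move=> subA; elim: l x => [|y l IH] x /= lA; first by move=> ->; exact: subA.1.
case=> z /IH Axy; rewrite -[x](subrK (y *~ z)); apply: (is_subgroupD subA).
  by apply: Axy => w wl; apply: lA; rewrite inE wl orbT.
by apply: is_subgroupMz => //; apply: lA; rewrite inE eqxx.
Qed.

Lemma zspan_comb l x :
  zspan l x <-> exists a : 'I_(size l) -> int, x = \sum_(i < size l) l`_i *~ a i.
Proof.
elim: l x => [|y l IH] x /=.
  split=> [->|[a ->]]; last by rewrite big_ord0.
  by exists (fun=> 0); rewrite big_ord0.
split=> [[z /IH[a xE]]|[a ->]].
  exists (fun i => if unlift ord0 i is Some j then a j else z).
  rewrite big_ord_recl unlift_none /= -[LHS](subrK (y *~ z)) addrC xE.
  by congr (_ + _); apply: eq_bigr => i _; rewrite liftK.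
exists (a ord0); apply/IH; exists (fun i => a (lift ord0 i)).
by rewrite big_ord_recl addrC addKr.
Qed.

Lemma indep_comb l (a : 'I_(size l) -> int) :
  indep l -> \sum_(i < size l) l`_i *~ a i = 0 -> forall i, a i = 0.
Proof.
elim: l a => [|y l IH] a /=; first by move=> _ _ [].
case=> indl indy; rewrite big_ord_recl /= => /eqP; rewrite addr_eq0 => /eqP yE.
have a0 : a ord0 = 0.
  apply: indy; rewrite yE; apply: (is_subgroupN (zspan_subgroup l)).
  by apply/zspan_comb; eexists.
move: yE; rewrite a0 mulr0z => /esym/eqP; rewrite oppr_eq0 => /eqP.
move=> /(IH (fun i => a (lift ord0 i)) indl) al i.
by case: (unliftP ord0 i) => [j ->|->].
Qed.

Lemma indep_extend l :
  indep l -> rational_basis l \/ exists x, indep (x :: l).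
Proof.
move=> indl; have [[x indx]|maxl] := pselect (exists x, indep (x :: l)).
  by right; exists x.
left; split=> // g; apply: contrapT => nog; apply: maxl; exists g; split=> //.
case=> [[//|n]|n] spn; case: nog; exists n.+1 => //.
by have := is_subgroupN (zspan_subgroup l) spn; rewrite NegzE mulrNz opprK.
Qed.

End SpanTheory.

Lemma zspan_map (G K : zmodType) (f : {additive G -> K}) l x :
  zspan (map f l) x <-> exists2 w, zspan l w & f w = x.
Proof.
elim: l x => [|y l IH] x /=.
  by split=> [->|[w -> <-]]; [exists 0; rewrite ?raddf0|rewrite raddf0].
split=> [[z /IH[w spw fw]]|[w [z spw] <-]].
  exists (w + y *~ z); first by exists z; rewrite addrK.
  by rewrite raddfD raddfMz fw subrK.
by exists z; apply/IH; eexists; first exact: spw; rewrite raddfB raddfMz.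
Qed.

Lemma indep_of_map (G K : zmodType) (f : {additive G -> K}) l :
  indep (map f l) -> indep l.
Proof.
elim: l => //= y l IH [/IH indl indy]; split=> // z spz.
by apply: indy; apply/zspan_map; eexists; first exact: spz; rewrite raddfMz.
Qed.

Lemma indep_map (G K : zmodType) (f : {additive G -> K}) l :
  (forall x, f x = 0 -> in_torsion x) -> indep l -> indep (map f l).
Proof.
move=> kerf; elim: l => //= y l IH [indl indy]; split; first exact: IH.
move=> z /zspan_map[w spw fw].
have [|n n_gt0 yw] := kerf (y *~ z - w); first by rewrite raddfB fw raddfMz subrr.
have /eqP : z * n%:Z = 0.
  apply: indy; rewrite mulrzA -pmulrn.
  move: yw; rewrite mulrnBl => /eqP; rewrite subr_eq0 => /eqP ->.
  exact: (is_subgroupMn (zspan_subgroup l) _ spw).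
by rewrite mulf_eq0 -[X in _ || X]/(n == 0)%N (gtn_eqF n_gt0) orbF => /eqP.
Qed.

Lemma zspan_inj (G K : zmodType) (f : {additive G -> K}) l w :
  indep (map f l) -> zspan l w -> f w = 0 -> w = 0.
Proof.
elim: l w => //= y l IH w [indl indy] [z spw] fw.
have z0 : z = 0.
  apply: indy; apply/zspan_map; exists (y *~ z - w).
    by rewrite -opprB; exact: (is_subgroupN (zspan_subgroup l)).
  by rewrite raddfB raddfMz fw subr0.
by apply: IH => //; move: spw; rewrite z0 mulr0z subr0.
Qed.

(** * Finite torsion-free rank means having a rational basis *)

Lemma rat_clear (q : rat) : exists2 n, (0 < n)%N & exists z : int, q *+ n = z%:~R.
Proof.
exists `|denq q|%N; first by rewrite absz_gt0 denq_neq0.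
exists (numq q); rewrite -mulr_natr natr_absz ger0_norm ?denq_ge0 //.
by rewrite numqE.
Qed.

Section BiadditiveTheory.
Variables (A B C : zmodType) (b : A -> B -> C).
Hypothesis bb : biadditive b.

Lemma biadditive_left y : exists f : {additive A -> C}, forall x, f x = b x y.
Proof.
apply: additive_of_morphism => x x'; apply/eqP.
by rewrite eq_sym subr_eq -bb.1 subrK.
Qed.

Lemma biadditive_right x : exists f : {additive B -> C}, forall y, f y = b x y.
Proof.
apply: additive_of_morphism => y y'; apply/eqP.
by rewrite eq_sym subr_eq -bb.2 subrK.
Qed.

End BiadditiveTheory.

(** If [x] has infinite order, the map sending [x] to 1 extends to a
    homomorphism from [G] to the rationals, and the biadditive map that it
    defines takes the value 1 at [(x, 1)]. *)
Lemma rational_tensor_torsion (G : zmodType) (V : lmodType rat)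
    (t : G -> rat -> V) x :
  is_rational_tensor t -> t x 1 = 0 -> in_torsion x.
Proof.
case=> _ univ _ tx0; apply: contrapT => ntx.
have xMz0 (m : int) : x *~ m = 0 -> m = 0.
  case: m => [[//|n]|n] xn; case: ntx; exists n.+1 => //.
  by apply/eqP; rewrite -oppr_eq0; apply/eqP.
have [|||f fE] := @Baer_extension G rat
    (fun y => exists m : int, y = (x *~ m, m%:~R)).
- split; first by exists 0; rewrite !mulr0z.
  by move=> _ _ [m ->] [m' ->]; exists (m - m'); rewrite !mulrzBr.
- by move=> d [m [/esym/xMz0 -> ->]].
- move=> g n d n_gt0 _; exists (d / n%:R).
  by rewrite -mulrnAr -[_ *+ n]mulr_natr mulVf ?mulr1 // pnatr_eq0 -lt0n.
have [|h [hE _]] := univ rat (fun g q => f g * q).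
  by split=> *; rewrite ?raddfD ?mulrDl ?mulrDr.
have := hE x 1; rewrite tx0 raddf0 (fE x 1) ?mulr1; last by exists 1; rewrite !mulr1z.
by move/eqP; rewrite eq_sym oner_eq0.
Qed.

(** An independent family is sent to a linearly independent one: clearing the
    denominators in a linear relation gives an integral relation that holds up
    to torsion. *)
Lemma indep_size_bounded (G : zmodType) :
  finite_torsion_free_rank G ->
  exists n, forall l : seq G, indep l -> (size l <= n)%N.
Proof.
case=> n [V [t [tensor _]]]; exists (\dim (fullv : {vspace V})) => l.
have [bt _ _] := tensor; have [phi phiE] := biadditive_left bt 1.
have clear v : forall l, v \in <<map phi l>>%VS ->
    exists2 n, (0 < n)%N & exists2 g, zspan l g & v *+ n = phi g.
  move=> {}l; elim: l v => [|y l IH] v.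
    rewrite /= span_nil memv0 => /eqP ->; exists 1%N => //; exists 0 => //.
    by rewrite raddf0.
  rewrite /= vector.span_cons => /memv_addP[_ /vlineP[q ->] [w /IH[m m_gt0 [g spg wE]] ->]].
  have [k k_gt0 [z qE]] := rat_clear q.
  exists (k * m)%N; first by rewrite muln_gt0 k_gt0.
  exists (y *~ z *+ m + g *+ k).
    exists (z * m%:Z); rewrite mulrzA -pmulrn addrC addKr.
    exact: (is_subgroupMn (zspan_subgroup l) _ spg).
  rewrite raddfD raddfMn raddfMn raddfMz -wE mulrnDl mulrnA -[in RHS]mulrnA.
  rewrite [(m * k)%N]mulnC; congr (_ *+ _ + _).
  by rewrite scalerMnl qE scaler_int.
move=> indl; suff : free (map phi l).
  by rewrite /free => /eqP; rewrite size_map => <-; rewrite dimvS ?subvf.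
elim: l indl => [|y l IH] /=; first by rewrite nil_free.
case=> indl indy; rewrite free_cons IH // andbT; apply/negP => /clear.
case=> m m_gt0 [g spg gE].
have [|k k_gt0 yg] := @rational_tensor_torsion G V t (y *+ m - g) tensor.
  by rewrite -phiE raddfB raddfMn gE subrr.
have /eqP : (m * k)%:Z = 0.
  apply: indy; rewrite -pmulrn mulrnA.
  move: yg; rewrite mulrnBl => /eqP; rewrite subr_eq0 => /eqP ->.
  exact: (is_subgroupMn (zspan_subgroup l) _ spg).
by rewrite -[_ == 0 :> int]/(m * k == 0)%N muln_eq0 !gtn_eqF.
Qed.

Lemma max_indep (G : zmodType) n :
  (forall l : seq G, indep l -> (size l <= n)%N) ->
  exists2 l : seq G, indep l & forall l' : seq G, indep l' -> (size l' <= size l)%N.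
Proof.
move=> bound; apply: contrapT => nomax.
have [l lsize indl] : exists2 l : seq G, (n < size l)%N & indep l.
  elim: n.+1 => [|k [l lk indl]]; first by exists [::].
  apply: contrapT => nol; apply: nomax; exists l => // l' indl'.
  rewrite leqNgt; apply/negP => ll'; apply: nol; exists l' => //.
  exact: leq_ltn_trans lk ll'.
by have := bound l indl; rewrite leqNgt lsize.
Qed.

Lemma rational_basis_exists (G : zmodType) :
  finite_torsion_free_rank G -> exists l : seq G, rational_basis l.
Proof.
move=> /indep_size_bounded[n /max_indep[l indl maxl]].
case: (indep_extend indl) => [bl|[x /maxl]]; first by exists l.
by rewrite ltnn.
Qed.

(** The tensor product with the rationals is realized by the coordinates on a
    rational basis; they extend from the zspan to all of [G] because the space
    of coordinates is divisible. *)
Lemma finite_rank_of_basis (G : zmodType) (l : seq G) :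
  rational_basis l -> finite_torsion_free_rank G.
Proof.
case=> indl maxl; pose n := size l; pose V := 'rV[rat]_n.
have [|||phi phiE] := @Baer_extension G V (fun y => exists a : 'I_n -> int,
    y = (\sum_(i < size l) l`_i *~ a i, \row_i (a i)%:~R)).
- split.
    exists (fun=> 0); congr (_, _); first by rewrite big1 // => i _; rewrite mulr0z.
    by apply/rowP => i; rewrite !mxE.
  move=> _ _ [a ->] [a' ->]; exists (fun i => a i - a' i); congr (_, _).
    by rewrite -sumrB; apply: eq_bigr => i _; rewrite mulrzBr.
  by apply/rowP => i; rewrite !mxE mulrzBr.
- move=> d [a [/esym/(indep_comb indl) a0 ->]].
  by apply/rowP => i; rewrite !mxE a0.
- move=> g m d m_gt0 _; exists (m%:R^-1 *: d).
  by rewrite scalerMnl -mulr_natr mulVf ?scale1r // pnatr_eq0 -lt0n.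
have phi_basis (i : 'I_n) : phi l`_i = delta_mx 0 i.
  apply: phiE; exists (fun j => (j == i)%:Z); congr (_, _).
    rewrite (bigD1 i) //= eqxx mulr1z big1 ?addr0 // => j /negPf ->.
    by rewrite mulr0z.
  by apply/rowP => j; rewrite !mxE eqxx /=; case: (j == i).
exists (\dim (fullv : {vspace V})), V, (fun g q => q *: phi g); split=> //; split.
- by split=> *; rewrite ?raddfD ?scalerDl ?scalerDr.
- move=> W b bb.
  have [|F FE] := @additive_of_morphism V W (fun v => \sum_(i < n) b l`_i (v 0 i)).
    move=> v w; rewrite -sumrB; apply: eq_bigr => i _.
    have [h hE] := biadditive_right bb l`_i.
    by rewrite -!hE -raddfB !mxE.
  exists F; split=> [g q|f' f'E v]; rewrite FE.
    have [m m_gt0 /zspan_comb[a gE]] := maxl g.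
    have mQ : m%:R != 0 :> rat by rewrite pnatr_eq0 -lt0n.
    have phig i : phi g 0 i = (a i)%:~R / m%:R.
      have : phi (g *+ m) = \row_j (a j)%:~R by apply: phiE; exists a; rewrite gE.
      move/rowP/(_ i); rewrite raddfMn mxE => <-.
      by rewrite mulmxnE -[X in X / _]mulr_natr mulfK.
    have [h hE] := biadditive_left bb (q / m%:R).
    have [k kE] := biadditive_right bb g.
    have -> : b g q = h (g *+ m).
      rewrite -kE -{1}[q](divfK mQ) mulr_natr raddfMn kE -hE.
      by rewrite raddfMn.
    rewrite gE raddf_sum; apply: eq_bigr => i _.
    have [k' k'E] := biadditive_right bb l`_i.
    rewrite raddfMz hE -!k'E -raddfMz mxE phig; congr (k' _).
    by rewrite -[RHS]mulrzr [RHS]mulrAC mulrA.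
  rewrite {1}[v]matrix_sum_delta big_ord1 raddf_sum; apply: eq_bigr => i _.
  by rewrite -phi_basis f'E.
- by move=> a x q; rewrite scalerA.
Qed.

(** * Homomorphisms from a free group of countable rank *)

(** The first [n] terms of [x], latest first, so that extending a prefix adds
    one element at the head of the list. *)
Fixpoint prefix_of (T : Type) (x : nat -> T) (n : nat) : seq T :=
  if n is m.+1 then x m :: prefix_of x m else [::].

Lemma dependent_sequence (T : Type) (I : seq T -> Prop)
    (Q : nat -> seq T -> T -> Prop) :
  I [::] -> (forall n l, I l -> exists x, Q n l x /\ I (x :: l)) ->
  exists x : nat -> T, forall n,
    I (prefix_of x n) /\ Q n (prefix_of x n) (x n).
Proof.
move=> I0 step; have [x0 _] := step 0%N [::] I0.
have [|c cE] := @choice (nat * seq T)%type T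
    (fun p x => I p.2 -> Q p.1 p.2 x /\ I (x :: p.2)).
  move=> [n l] /=; have [Il|nIl] := pselect (I l); last by exists x0.
  by have [x Qx] := step n l Il; exists x.
pose L := fix L n := if n is m.+1 then c (m, L m) :: L m else [::].
exists (fun n => c (n, L n)) => n.
have pE m : prefix_of (fun n => c (n, L n)) m = L m by elim: m => //= m ->.
have IL m : I (L m) by elim: m => //= m /(cE (m, L m))[].
by rewrite pE; split=> //; have [] := cE (n, L n) (IL n).
Qed.

Section Combinations.
Variables (G : zmodType) (x : nat -> G).

Lemma zspan_prefix n (a : nat -> int) :
  zspan (prefix_of x n) (\sum_(i < n) x i *~ a i).
Proof.
elim: n => [|n IH] /=; first by rewrite big_ord0.
by exists (a n); rewrite big_ord_recr /= addrK.
Qed.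

Lemma comb_eq0 :
  (forall n z, zspan (prefix_of x n) (x n *~ z) -> x n *~ z = 0) ->
  forall n (a : nat -> int), \sum_(i < n) x i *~ a i = 0 ->
  forall i, (i < n)%N -> x i *~ a i = 0.
Proof.
move=> indx; elim=> [|n IH] a // sum0 i.
have xn0 : x n *~ a n = 0.
  apply: indx; move/eqP: sum0; rewrite big_ord_recr /= addrC addr_eq0 => /eqP ->.
  by apply: (is_subgroupN (zspan_subgroup _)); exact: zspan_prefix.
rewrite ltnS leq_eqVlt => /predU1P[->|]; first exact: xn0.
by apply: IH; move: sum0; rewrite big_ord_recr /= xn0 addr0.
Qed.

(** Integer polynomials are used as the free group on the powers of ['X]. *)
Lemma free_hom : exists e : {additive {poly int} -> G},
  (forall P : {poly int}, e P = \sum_(i < size P) x i *~ P`_i) /\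
  forall n, e 'X^n = x n.
Proof.
have widen n (P : {poly int}) : (size P <= n)%N ->
    \sum_(i < size P) x i *~ P`_i = \sum_(i < n) x i *~ P`_i.
  move=> Pn; rewrite (big_ord_widen n (fun i => x i *~ P`_i)) // big_mkcond /=.
  by apply: eq_bigr => i _; case: ltnP => // Pi; rewrite nth_default // mulr0z.
have [|e eE] := @additive_of_morphism {poly int} G
    (fun P => \sum_(i < size P) x i *~ P`_i).
  move=> P R; pose n := maxn (size P) (size R).
  rewrite (widen n P) ?leq_maxl // (widen n R) ?leq_maxr // (widen n).
    by rewrite -sumrB; apply: eq_bigr => i _; rewrite coefB mulrzBr.
  by rewrite (leq_trans (size_polyD _ _)) // size_polyN.
exists e; split=> // n.
rewrite eE (widen n.+1) ?size_polyXn // big_ord_recr /= coefXn eqxx mulr1z.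
rewrite big1 ?add0r // => i _.
by rewrite coefXn (ltn_eqF (ltn_ord i)) mulr0z.
Qed.

End Combinations.

Definition rat_poly_enum (i : nat) : {poly rat} := odflt 0 (unpickle i).

Lemma rat_poly_enumK q : rat_poly_enum (pickle q) = q.
Proof. by rewrite /rat_poly_enum pickleK. Qed.

Lemma divisible_rat_poly : divisible {poly rat}.
Proof.
move=> n d n_gt0; exists (n%:R^-1 *: d).
by rewrite scalerMnl -mulr_natr mulVf ?scale1r // pnatr_eq0 -lt0n.
Qed.

(** If there were no rational basis, [G] would contain a free group of infinite
    countable rank, here the integral polynomials.  It embeds into the rational
    polynomials, a countable divisible group, and also maps onto them, one basis
    element being sent to 0 and the others to an enumeration. *)
Lemma Bassian_rational_basis (G : zmodType) :
  Bassian G -> exists l : seq G, rational_basis l.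
Proof.
move=> BG; apply: contrapT => nobasis.
have [||x xE] := @dependent_sequence G (@indep G) (fun _ _ _ => True); first by [].
  move=> _ l /indep_extend[bl|[x indx]]; last by exists x.
  by case: nobasis; exists l.
have indx n z : zspan (prefix_of x n) (x n *~ z) -> z = 0.
  by case: (xE n.+1) => -[_ ind] _ /ind.
have [e [eE _]] := free_hom x.
have e_inj P : e P = 0 -> P = 0.
  rewrite eE => sum0; apply/polyP => i; rewrite coef0.
  have [Pi|Pi] := ltnP i (size P); last by rewrite nth_default.
  apply: (indx i); rewrite (comb_eq0 (a := nth 0 P) _ sum0) //.
    by case: (zspan_subgroup (prefix_of x i)).
  by move=> n z /indx ->; rewrite mulr0z.
have [sigma [_ sigmaE]] := free_hom
  (fun i => if i is j.+1 then rat_poly_enum j else 0).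
have : e 1 = 0.
  apply: (@Bassian_obstruction G {poly int} {poly rat} e sigma
    (map_poly (intr : int -> rat))) => //.
  - exact: divisible_rat_poly.
  - by move=> d; exists 'X^((pickle d).+1); rewrite sigmaE rat_poly_enumK.
  - by move=> u /e_inj ->; rewrite raddf0.
  - move=> u; have [->|u_neq0] := eqVneq u 0; first by rewrite !raddf0.
    split=> [/e_inj|] /eqP; first by rewrite (negPf u_neq0).
    by rewrite map_poly_eq0_id0 ?intr_eq0 ?lead_coef_eq0 // (negPf u_neq0).
  - by rewrite -(expr0 'X) sigmaE.
by move/e_inj/eqP; rewrite oner_eq0.
Qed.

(** * Multiples of torsion elements *)

Definition p_torsion (G : zmodType) (p : nat) (x : G) : Prop :=
  exists k, x *+ (p ^ k) = 0.

Lemma p_torsionP (G : zmodType) (p : nat) (x : G) : prime p ->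
  in_primary_torsion p x <-> p_torsion p x.
Proof.
move=> p_pr; split=> [[]//|[k xk]]; split; last by exists k.
by exists (p ^ k)%N => //; rewrite expn_gt0 prime_gt0.
Qed.

Lemma p_torsion_subgroup (G : zmodType) (p : nat) : is_subgroup (@p_torsion G p).
Proof.
split=> [|x y [j xj] [k yk]]; first by exists 0%N; rewrite mul0rn.
by exists (j + k)%N; rewrite mulrnBl expnD mulrnA xj mulnC mulrnA yk !mul0rn subrr.
Qed.

Lemma Bezout_mulrn (G : zmodType) (x : G) n q :
  (0 < n)%N -> x *+ q = 0 -> exists v, x *+ v *+ n = x *+ gcdn n q.
Proof.
move=> n_gt0 xq; case: (egcdnP q n_gt0) => v w vE _.
by exists v; rewrite -mulrnA vE mulrnDr mulnC mulrnA xq mul0rn add0r.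
Qed.

(** The integers that multiply [x] into [A] form an ideal that contains
    [p ^ k.+1]; its generator is a power of [p], and it does not divide [p ^ k]
    when [p ^ k] is outside the ideal. *)
Lemma subgroup_prime_power (G : zmodType) (A : G -> Prop) p k (x : G) (z : int) :
  prime p -> is_subgroup A -> A (x *+ (p ^ k.+1)) -> A (x *~ z) ->
  ~ A (x *+ (p ^ k)) -> exists c : int, z = (p ^ k.+1)%N%:Z * c.
Proof.
move=> p_pr subA Aq Az nA.
have {Az} Az : A (x *+ `|z|%N).
  case: z Az => n //; rewrite NegzE mulrNz => /(is_subgroupN subA).
  by rewrite opprK.
suff /dvdnP[c zE] : (p ^ k.+1 %| `|z|)%N.
  exists (sgz z * c%:Z); rewrite [LHS]intEsg abszE -abszE zE PoszM.
  by rewrite [RHS]mulrCA [c%:Z * _]mulrC.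
have [z_gt0|] := ltnP 0 `|z|%N; last by rewrite leqn0 => /eqP ->.
case: (egcdnP (p ^ k.+1) z_gt0) => v w vE _.
have Agcd : A (x *+ gcdn `|z| (p ^ k.+1)).
  have := subA.2 _ _ (is_subgroupMn subA v Az) (is_subgroupMn subA w Aq).
  by rewrite -!mulrnA ![(_ * v)%N]mulnC vE mulnC mulrnDr addrC addKr.
have /(dvdn_pfactor _ _ p_pr)[j jk gE] := dvdn_gcdr `|z|%N (p ^ k.+1).
have [j_le|] := leqP j k.
  case: nA; rewrite -(subnKC j_le) expnD mulrnA -gE.
  exact: is_subgroupMn.
move=> k_lt; have -> : k.+1 = j by apply/eqP; rewrite eqn_leq k_lt jk.
by rewrite -gE dvdn_gcdl.
Qed.

(** * Residues of a finitely generated subgroup *)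

Fixpoint residues (G : zmodType) (q : nat) (l : seq G) : seq G :=
  if l is y :: l' then [seq y *+ c + r | c <- iota 0 q, r <- residues q l']
  else [:: 0].

Lemma residuesP (G : zmodType) q (l : seq G) x : (0 < q)%N -> zspan l x ->
  exists2 r, r \in residues q l & exists2 w, zspan l w & x = r + w *+ q.
Proof.
move=> q_gt0; elim: l x => [|y l IH] x /=.
  by move=> ->; exists 0; rewrite ?inE //; exists 0; rewrite ?mul0rn ?addr0.
case=> z /IH[r rl [w spw xE]].
have q_neq0 : q%:Z != 0 by rewrite -lt0n.
have [c cE] : exists c : nat, (z %% q)%Z = c.
  by exists `|(z %% q)%Z|%N; rewrite gez0_abs ?modz_ge0.
exists (y *+ c + r).
  apply/allpairsP; exists (c, r); split=> //=.
  by rewrite mem_iota add0n -ltz_nat -cE ltz_pmod.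
exists (w + y *~ (z %/ q)%Z).
  by exists (z %/ q)%Z; rewrite addrK.
rewrite -[LHS](subrK (y *~ z)) xE {1}(divz_eq z q) cE mulrzDr.
rewrite mulrnDl -pmulrn mulrzA -pmulrn [y *+ c + r]addrC.
by rewrite [_ + y *~ c]addrC addrACA.
Qed.

(** * Bassian groups have bounded primary components *)

(** Multiplication by [p] maps [U] onto itself, so that the quotient of [U] by
    its socle is a copy of [U]; it is divisible because integers coprime to [p]
    act invertibly on [p]-torsion elements. *)
Lemma Bassian_p_divisible (G : zmodType) (p : nat) (U : G -> Prop) :
  prime p -> is_subgroup U -> (forall x, U x -> p_torsion p x) ->
  (forall x, U x -> exists2 y, U y & y *+ p = x) ->
  Bassian G -> forall x, U x -> x = 0.
Proof.
move=> p_pr subU torsU divU BG.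
have [A AE] := zmodClosed_of_is_subgroup subU.
have valMn (u : subgroup A) n : val (u *+ n) = val u *+ n by rewrite raddfMn.
have divA : divisible (subgroup A).
  move=> n d n_gt0.
  have pdiv (u : subgroup A) k : exists v, v *+ (p ^ k) = u.
    elim: k u => [|k IH] u; first by exists u.
    have [v vE] := IH u; have [y /AE Ay yE] := divU (val v) (proj1 (AE _) (valP v)).
    exists (Sub y Ay); rewrite expnS mulrnA; apply/val_inj.
    by rewrite -vE !valMn SubK yE.
  have [c d'E] := pdiv d (logn p n).
  have [k ck] := torsU (val c) (proj1 (AE _) (valP c)).
  have {}ck : c *+ (p ^ k) = 0 by apply/val_inj; rewrite valMn ck raddf0.
  have m_gt0 : (0 < n`_p^')%N by [].
  have [v vE] := Bezout_mulrn m_gt0 ck.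
  exists (c *+ v); rewrite -[n](partnC p n_gt0) mulnC mulrnA vE.
  have -> : gcdn n`_p^' (p ^ k) = 1%N.
    apply/eqP; rewrite -/(coprime _ _) coprime_sym coprimeXl //.
    by rewrite (pnat_coprime (pnat_id p_pr)) ?part_pnat.
  by rewrite mulr1n p_part.
have [sigma sigmaE] := @additive_of_morphism (subgroup A) (subgroup A)
  (fun u => u *+ p) (fun u v => mulrnBl p u v).
have [e eE] := @additive_of_morphism (subgroup A) G val (raddfB _).
have [tau tauE] := @additive_of_morphism (subgroup A) (subgroup A)
  id (fun _ _ => erefl).
have val0 (u : subgroup A) : val u = 0 <-> u = 0.
  by split=> [u0|->]; [apply/val_inj; rewrite u0 raddf0|rewrite raddf0].
have obstruct u : U u -> u *+ p = 0 -> u = 0.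
  move=> /AE Au up.
  have := @Bassian_obstruction G _ _ e sigma tau divA _ _ _ BG (Sub u Au).
  rewrite eE SubK; apply.
  - move=> d; have [v vE] := divA p d (prime_gt0 p_pr).
    by exists v; rewrite sigmaE.
  - by move=> w; rewrite eE sigmaE => /val0 ->; rewrite mul0rn.
  - by move=> w; rewrite eE tauE val0.
  - by rewrite sigmaE; apply/val0; rewrite valMn SubK.
move=> x Ux; have [k] := torsU x Ux.
elim: k x Ux => [|k IH] x Ux //; rewrite expnS mulrnA => /IH.
by move=> /(_ (is_subgroupMn subU _ Ux)); exact: obstruct.
Qed.

(** The quotient of the rational polynomials by this subgroup is the direct sum
    of countably many quasicyclic [p]-groups. *)
Definition locally_integral (p : nat) (f : {poly rat}) : Prop :=
  exists m, [/\ (0 < m)%N, coprime p m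
    & forall i, exists z : int, f`_i *+ m = z%:~R].

Lemma locally_integral_subgroup p : is_subgroup (locally_integral p).
Proof.
split=> [|f g [m [m_gt0 pm fm]] [n [n_gt0 pn gn]]].
  by exists 1%N; split; rewrite ?coprimen1 // => i; exists 0; rewrite coef0.
exists (m * n)%N; split; rewrite ?muln_gt0 ?m_gt0 ?coprimeMr ?pm // => i.
have [z zE] := fm i; have [t tE] := gn i; exists (z * n%:Z - t * m%:Z).
rewrite coefB mulrnBl mulrnA zE mulnC mulrnA tE intrB !intrM.
by rewrite !mulr_natr.
Qed.

Lemma locally_integral_p_power p f :
  prime p -> exists k, locally_integral p (f *+ (p ^ k)).
Proof.
move=> p_pr.
have [n n_gt0 nE] : exists2 n, (0 < n)%N &
    forall i, exists z : int, f`_i *+ n = z%:~R.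
  elim/poly_ind: f => [|f c [n n_gt0 nE]].
    by exists 1%N => // i; exists 0; rewrite coef0.
  have [m m_gt0 [z mE]] := rat_clear c.
  exists (m * n)%N; first by rewrite muln_gt0 m_gt0.
  move=> i; rewrite coefD coefMX coefC; case: i => [|i] /=.
    by exists (z * n%:Z); rewrite add0r mulrnA mE intrM mulr_natr.
  have [t tE] := nE i; exists (t * m%:Z).
  by rewrite addr0 mulnC mulrnA tE intrM mulr_natr.
exists (logn p n), (n`_p^')%N; split; first by [].
  by rewrite (pnat_coprime (pnat_id p_pr)) ?part_pnat.
move=> i; have [z zE] := nE i; exists z.
by rewrite coefMn -mulrnA -p_part partnC.
Qed.

(** Let [D] be the direct sum of countably many quasicyclic [p]-groups and [d]
    an enumeration of it starting with 0.  Choose [h] so that [d n] is killed by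
    [p ^ (h n).+1], the order of [y n].  As the multiples of the [y n] in the
    socle are independent, the [y n] generate a direct sum of cyclic groups: it
    maps onto [D] by sending [y n] to [d n], and embeds into [D] by sending [y n]
    to an element of order [p ^ (h n).+1] in the summand of index [n]. *)
Lemma Bassian_no_socle_sequence (G : zmodType) (p : nat) :
  prime p ->
  (forall h : nat -> nat, exists y : nat -> G, forall n,
     y n *+ (p ^ (h n).+1) = 0 /\
     ~ zspan (prefix_of (fun i => y i *+ (p ^ h i)) n) (y n *+ (p ^ h n))) ->
  ~ Bassian G.
Proof.
move=> p_pr ex_seq BG.
have ppow_neq0 k : (p ^ k)%:R != 0 :> rat.
  by rewrite pnatr_eq0 -lt0n expn_gt0 prime_gt0.
have [M ME] := zmodClosed_of_is_subgroup (locally_integral_subgroup p).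
have [q [qE q_onto]] := quotient_map M.
pose D := Quotient.quot M.
pose d i : D := if i is j.+1 then q (rat_poly_enum j) else 0.
have [h hE] : exists h : nat -> nat, forall i, d i *+ (p ^ (h i).+1) = 0.
  suff /choice[h hE] : forall i, exists k, d i *+ (p ^ k.+1) = 0 by exists h.
  case=> [|j] /=; first by exists 0%N; rewrite mul0rn.
  have [k kE] := locally_integral_p_power (rat_poly_enum j) p_pr.
  have q0 : q (rat_poly_enum j *+ (p ^ k)) = 0 by apply/qE/ME.
  by exists k; rewrite expnSr mulrnA; rewrite raddfMn in q0; rewrite q0 mul0rn.
have [y yE] := ex_seq h.
have yq n : y n *+ (p ^ (h n).+1) = 0 by case: (yE n).
have ind n : ~ zspan (prefix_of (fun i => y i *+ (p ^ h i)) n) (y n *+ (p ^ h n)).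
  by case: (yE n).
have yneq0 n : y n *+ (p ^ h n) <> 0.
  by move=> y0; apply: (ind n); rewrite y0; case: (zspan_subgroup
    (prefix_of (fun i => y i *+ (p ^ h i)) n)).
have trivial_sub : is_subgroup (fun x : G => x = 0).
  by split=> // x x' -> ->; rewrite subr0.
have ordy n (z : int) : y n *~ z = 0 -> exists c : int, z = (p ^ (h n).+1)%N%:Z * c.
  by move=> yz; apply: (subgroup_prime_power p_pr trivial_sub (yq n) yz (yneq0 n)).
have ind_socle n (z : int) : zspan (prefix_of (fun i => y i *+ (p ^ h i)) n)
    (y n *+ (p ^ h n) *~ z) -> y n *+ (p ^ h n) *~ z = 0.
  move=> spz; have subA := zspan_subgroup (prefix_of (fun i => y i *+ (p ^ h i)) n).
  have [||c ->] := subgroup_prime_power (k := 0) p_pr subA _ spz _.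
  - by rewrite expn1 -mulrnA -expnSr yq; case: subA.
  - by rewrite expn0 mulr1n.
  by rewrite expn1 mulrzA -pmulrn -mulrnA -expnSr yq mul0rz.
have yterm n (a : nat -> int) : \sum_(i < n) y i *~ a i = 0 ->
    forall i, (i < n)%N -> y i *~ a i = 0.
  have [k] : exists k, forall i, (i < n)%N -> y i *~ a i *+ (p ^ k) = 0.
    exists (\sum_(i < n) (h i).+1)%N => i i_lt.
    rewrite (bigD1 (Ordinal i_lt)) //= expnD mulrnA.
    by rewrite [_ *+ (p ^ (h i).+1)]pmulrn mulrzAC -pmulrn yq mul0rz mul0rn.
  (* The multiples by [p ^ k] of the terms lie in the socle, where they are
     multiples of independent elements; so they vanish, which lowers [k]. *)
  elim: k a => [|k IH] a ak sum0; first exact: ak.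
  apply: IH => // i i_lt.
  have [c cE] : exists c : nat -> int, forall j, (j < n)%N ->
      a j * (p ^ k)%N%:Z = (p ^ h j)%N%:Z * c j.
    suff /choice[c cE] : forall j, exists c : int, (j < n)%N ->
      a j * (p ^ k)%N%:Z = (p ^ h j)%N%:Z * c by exists c.
    move=> j.
    have [j_lt|] := ltnP j n; last by exists 0.
    have [|c cE] := @ordy j (a j * (p ^ k.+1)%N%:Z).
      by rewrite mulrzA -pmulrn ak.
    exists c => _; apply: (mulIf (_ : p%:Z != 0)); first by rewrite -lt0n prime_gt0.
    by rewrite -mulrA -PoszM -expnSr cE expnSr PoszM mulrAC.
  have shift j : (j < n)%N -> y j *~ a j *+ (p ^ k) = y j *+ (p ^ h j) *~ c j.
    by move=> j_lt; rewrite !pmulrn -!mulrzA cE.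
  rewrite shift //; move: i i_lt; apply: (comb_eq0 ind_socle).
  transitivity ((\sum_(i < n) y i *~ a i) *+ (p ^ k)); last by rewrite sum0 mul0rn.
  by rewrite -sumrMnl; apply: eq_bigr => i _; rewrite shift.
have [e [eE eX]] := free_hom y.
have e0 P : e P = 0 <-> forall i, exists c : int, P`_i = (p ^ (h i).+1)%N%:Z * c.
  rewrite eE; split=> [/(@yterm _ (nth 0 P)) termP i|divP].
    have [Pi|Pi] := ltnP i (size P); first exact: ordy (termP i Pi).
    by exists 0; rewrite nth_default ?mulr0.
  rewrite big1 // => i _; have [c ->] := divP i.
  by rewrite mulrzA -pmulrn yq mul0rz.
have [sigma [sigmaE sigmaX]] := free_hom d.
have [tau0 [tau0E tau0X]] :=
  free_hom (fun i => (p ^ (h i).+1)%:R^-1 *: 'X^i : {poly rat}).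
have tau0_coef P i : (tau0 P)`_i = (P`_i)%:~R / (p ^ (h i).+1)%:R.
  rewrite tau0E coef_sum.
  have coefT j : ((p ^ (h j).+1)%:R^-1 *: 'X^j *~ P`_j : {poly rat})`_i =
      if i == j then (P`_i)%:~R / (p ^ (h i).+1)%:R else 0.
    rewrite -scaler_int coefZ coefZ coefXn; case: eqP => [->|_].
      by rewrite mulr1.
    by rewrite !mulr0.
  have [Pi|Pi] := ltnP i (size P).
    rewrite (bigD1 (Ordinal Pi)) //= coefT eqxx big1 ?addr0 // => j jNi.
    by rewrite coefT; case: eqP => // ij; case/eqP: jNi; apply: val_inj.
  rewrite [P`_i]nth_default // mul0r big1 // => j _.
  by rewrite coefT (gtn_eqF (leq_trans (ltn_ord j) Pi)).
have tau0_int P : tau0 P \in M <->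
    forall i, exists c : int, P`_i = (p ^ (h i).+1)%N%:Z * c.
  rewrite ME; split=> [[m [m_gt0 pm mE]] i|divP].
    have [z zE] := mE i; suff /dvdzP[c ->] : ((p ^ (h i).+1)%N %| P`_i)%Z.
      by exists c; rewrite mulrC.
    rewrite -(@Gauss_dvdzl _ _ m%:Z); last by rewrite coprimezE coprimeXl.
    apply/dvdzP; exists z; apply: (@intr_inj rat); rewrite !intrM -zE tau0_coef.
    by rewrite -!pmulrn mulrnAl divfK ?mulr_natr.
  exists 1%N; split; rewrite ?coprimen1 // => i; have [c cE] := divP i.
  by exists c; rewrite mulr1n tau0_coef cE intrM -pmulrn mulrAC divff ?mul1r.
have : e 1 = 0.
  apply: (@Bassian_obstruction G {poly int} D e sigma (q \o tau0)) => //.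
  - move=> n x n_gt0; have [f <-] := q_onto x.
    by have [g <-] := divisible_rat_poly f n_gt0; exists (q g); rewrite raddfMn.
  - move=> x; have [f <-] := q_onto x.
    by exists 'X^((pickle f).+1); rewrite sigmaX /d rat_poly_enumK.
  - move=> u /e0 divu; rewrite sigmaE big1 // => i _; have [c ->] := divu i.
    by rewrite mulrzA -pmulrn hE mul0rz.
  - by move=> u; rewrite e0 -tau0_int -qE.
  - by rewrite -(expr0 'X) sigmaX.
by rewrite -(expr0 'X) eX => y0; apply: (yneq0 0%N); rewrite y0 mul0rn.
Qed.

(** The elements already chosen span a finite subgroup of the socle, so the next
    one only has to avoid a finite list. *)
Lemma socle_sequence (G : zmodType) (p : nat) :
  prime p ->
  (forall n (L : seq G),
    exists2 y : G, y *+ (p ^ n.+1) = 0 & y *+ (p ^ n) \notin L) ->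
  forall h : nat -> nat, exists y : nat -> G, forall n,
     y n *+ (p ^ (h n).+1) = 0 /\
     ~ zspan (prefix_of (fun i => y i *+ (p ^ h i)) n) (y n *+ (p ^ h n)).
Proof.
move=> p_pr infsoc h; pose soc (s : G) := s *+ p = 0.
have subsoc : is_subgroup soc.
  by split=> [|x y xp yp]; rewrite /soc ?mul0rn // mulrnBl xp yp subrr.
have [||s sE] := @dependent_sequence G (fun l => forall s, s \in l -> soc s)
  (fun n l s => (exists2 y, y *+ (p ^ (h n).+1) = 0 & y *+ (p ^ h n) = s) /\
     ~ zspan l s); first by [].
  move=> n l socl; have [y yq yL] := infsoc (h n) (residues p l).
  exists (y *+ (p ^ h n)); split; last first.
    move=> t; rewrite inE => /predU1P[->|/socl//].
    by rewrite /soc -mulrnA -expnSr.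
  split=> [|spy]; first by exists y.
  have [r rl [w spw wE]] := residuesP (prime_gt0 p_pr) spy.
  move: yL; rewrite wE (zspan_min subsoc socl spw : w *+ p = 0) addr0.
  by rewrite rl.
have /choice[y yE] : forall n, exists y,
    y *+ (p ^ (h n).+1) = 0 /\ y *+ (p ^ h n) = s n.
  by move=> n; have [_ [[y yq yn] _]] := sE n; exists y.
exists y => n; split; first by case: (yE n).
have -> : prefix_of (fun i => y i *+ (p ^ h i)) n = prefix_of s n.
  by elim: n => //= n ->; case: (yE n) => _ ->.
by case: (yE n) => _ ->; case: (sE n) => _ [].
Qed.

Lemma eventually_stable (T : eqType) (Q : nat -> T -> Prop) (L : seq T) n :
  (forall i j x, (i <= j)%N -> Q j x -> Q i x) ->
  exists2 m, (n <= m)%N & forall x, x \in L -> Q m x -> forall k, Q k x.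
Proof.
move=> antiQ; elim: L => [|x L [m nm mE]]; first by exists n.
have [[j nQj]|allQ] := pselect (exists j, ~ Q j x).
  exists (maxn m j) => [|t]; first by rewrite leq_max nm.
  rewrite inE => /predU1P[->|tL] Qt.
    by case: nQj; apply: antiQ Qt; exact: leq_maxr.
  by apply: mE tL _; apply: antiQ Qt; exact: leq_maxl.
exists m => // t; rewrite inE => /predU1P[->|/mE//] _ k.
by apply: contrapT => nQ; apply: allQ; exists k.
Qed.

(** When the socle of [p ^ n T_p] is finite for some [n], its decreasing
    filtration by height is stationary, so for some [m] all elements of the
    socle of [p ^ m T_p] have infinite height, which makes [p ^ m T_p]
    divisible.  Otherwise, independent elements of any prescribed orders can be
    found one after the other. *)
Lemma Bassian_bounded (G : zmodType) : Bassian G -> bounded_p_torsion G.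
Proof.
move=> BG p p_pr; pose T := @p_torsion G p; have subT := p_torsion_subgroup G p.
apply: contrapT => unbounded.
have [[n [L nL]]|infsoc] := pselect (exists n (L : seq G), forall y, T y ->
    y *+ (p ^ n.+1) = 0 -> y *+ (p ^ n) \in L); last first.
  apply: (Bassian_no_socle_sequence p_pr _ BG).
  apply: (socle_sequence p_pr _) => n L.
  apply: contrapT => noy; apply: infsoc; exists n, L => y Ty yq.
  by apply: contrapT => /negP yL; apply: noy; exists y.
pose S k (s : G) := s *+ p = 0 /\ exists2 y, T y & y *+ (p ^ k) = s.
have [|m nm stable] := @eventually_stable G S L n.
  move=> i j s ij [sp [y Ty yE]]; split=> //; exists (y *+ (p ^ (j - i))).
    exact: is_subgroupMn.
  by rewrite -mulrnA -expnD subnK.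
have Sm s : S m s -> forall k, S k s.
  move=> Ss; apply: stable (Ss); case: Ss => sp [y Ty yE].
  rewrite -yE -(subnK nm) expnD mulrnA; apply: nL; first exact: is_subgroupMn.
  by rewrite -mulrnA -expnD addnS subnK // expnSr mulrnA yE.
pose U x := exists2 y, T y & y *+ (p ^ m) = x.
have subU : is_subgroup U.
  split; first by exists 0; rewrite ?mul0rn //; exact: subT.1.
  by move=> _ _ [y Ty <-] [z Tz <-]; exists (y - z); [exact: subT.2|rewrite mulrnBl].
have divU x : U x -> exists2 v, U v & v *+ p = x.
  move=> Ux; have [j] : T x by case: Ux => y Ty <-; exact: is_subgroupMn.
  (* Subtracting [p] times an element of [U] from [x] cancels [x *+ (p ^ j)],
     which is in the socle and hence has infinite height. *)
  elim: j x Ux => [|j IH] x Ux xj.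
    by exists 0; rewrite ?mul0rn //; exact: subU.1.
  have /Sm/(_ (m + j.+1)%N)[_ [z Tz zE]] : S m (x *+ (p ^ j)).
    split; first by rewrite -mulrnA -expnSr.
    case: Ux => y Ty <-; exists (y *+ (p ^ j)); first exact: is_subgroupMn.
    by rewrite mulrnAC.
  have Uz : U (z *+ (p ^ m)) by exists z.
  have [||v Uv vE] := IH (x - z *+ (p ^ m) *+ p).
  - by apply: subU.2 => //; exact: is_subgroupMn.
  - by rewrite mulrnBl -zE -!mulrnA -expnS -expnD subrr.
  exists (v + z *+ (p ^ m)); first exact: is_subgroupD.
  by rewrite mulrnDl vE subrK.
apply: unbounded; exists m => y /(p_torsionP _ p_pr) Ty.
apply: (Bassian_p_divisible p_pr subU _ divU BG); last by exists y.
by move=> _ [z Tz <-]; exact: is_subgroupMn.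
Qed.

(** * Bassian groups from finiteness conditions *)

(** Let [f] embed [G] in [G/N].  Lifting the images of a maximal independent
    family of [G] gives a family that is independent modulo [N], so an element
    of infinite order in [N] would extend it; hence [N] is torsion.  Then each
    primary component [T_p] of [G] maps onto that of [G/N], so [f] induces an
    injection of the finite set [T_p] into itself whose image contains at most
    one element of [N]. *)
Lemma Bassian_of_finite (G : zmodType) (n : nat) :
  (forall l : seq G, indep l -> (size l <= n)%N) ->
  (forall p, prime p -> exists L : seq G, forall x, p_torsion p x -> x \in L) ->
  Bassian G.
Proof.
move=> /max_indep[l indl maxl] finT N [f f_inj] x Nx.
have [q [qE q_onto]] := quotient_map N.
have f0 y : f y = 0 -> y = 0 by rewrite -(raddf0 f) => /f_inj.
have torN y : y \in N -> in_torsion y.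
  move=> Ny; apply: contrapT => nty.
  have /choice[h hE] : forall g, exists h, q h = f g by move=> g; exact: q_onto.
  have indfl : indep (map q (map h l)).
    rewrite -map_comp (eq_map hE); apply: indep_map indl => z /f0 ->.
    by exists 1%N; rewrite ?mul0rn.
  have : indep (y :: map h l).
    split=> [|z spz]; first exact: indep_of_map indfl.
    have yz : y *~ z = 0.
      by apply: zspan_inj indfl spz _; apply/qE; rewrite rpredMz.
    apply/eqP; rewrite -absz_eq0 -leqn0 leqNgt; apply/negP => z_gt0; case: nty.
    exists `|z|%N => //; case: z yz {spz z_gt0} => k //.
    by rewrite NegzE mulrNz => /eqP; rewrite oppr_eq0 => /eqP.
  by move/maxl; rewrite /= size_map ltnn.
apply/eqP/negPn/negP => x_neq0.
have [p p_pr [y [Ny yp y_neq0]]] : exists2 p, prime p &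
    exists y, [/\ y \in N, y *+ p = 0 & y != 0].
  have /ex_minnP[m /andP[m_gt0 /eqP xm] min_m] :
      exists m, (0 < m)%N && (x *+ m == 0).
    by have [m m_gt0 xm] := torN x Nx; exists m; rewrite m_gt0 xm eqxx.
  have m_gt1 : (1 < m)%N.
    rewrite ltn_neqAle m_gt0 andbT eq_sym; apply: contraNneq x_neq0 => m1.
    by rewrite -[x]mulr1n -m1 xm.
  exists (pdiv m); first exact: pdiv_prime.
  exists (x *+ (m %/ pdiv m)); split; first exact: rpredMn.
    by rewrite -mulrnA divnK ?pdiv_dvd.
  apply/negP => /eqP ym.
  have := min_m (m %/ pdiv m)%N.
  rewrite divn_gt0 ?pdiv_gt0 // pdiv_leq // ym eqxx leqNgt.
  by rewrite ltn_Pdiv ?prime_gt1 ?pdiv_prime // => /(_ isT).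
have lift t : p_torsion p t -> exists2 t', p_torsion p t' & q t' = f t.
  case=> k tk; have [h hE] := q_onto (f t).
  have [|m m_gt0 hm] := torN (h *+ (p ^ k)).
    by apply/qE; rewrite raddfMn hE -raddfMn tk raddf0.
  have m'_gt0 : (0 < m`_p^')%N by [].
  have [|v vE] := @Bezout_mulrn _ (f t) m`_p^' (p ^ k) m'_gt0.
    by rewrite -raddfMn tk raddf0.
  exists (h *+ m`_p^' *+ v).
    exists (k + logn p m)%N; rewrite expnD mulrnA.
    rewrite (mulrnAC _ v) (mulrnAC _ v (p ^ logn p m)) (mulrnAC h).
    rewrite (mulrnAC _ _ (p ^ logn p m)) -p_part -[h *+ _ *+ _ *+ _]mulrnA.
    by rewrite partnC // hm mul0rn.
  rewrite !raddfMn hE mulrnAC vE (_ : gcdn _ _ = 1%N) //.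
  apply/eqP; rewrite -/(coprime _ _) coprime_sym coprimeXl //.
  by rewrite (pnat_coprime (pnat_id p_pr)) ?part_pnat.
have /choice[g gE] : forall t, exists t', p_torsion p t ->
    p_torsion p t' /\ q t' = f t.
  move=> t; have [/lift[t' Tt' t'E]|nTt] := pselect (p_torsion p t).
    by exists t'.
  by exists 0.
have [L LE] := finT p p_pr.
pose L' := undup [seq t <- L | `[< p_torsion p t >]].
have memL' t : t \in L' <-> p_torsion p t.
  rewrite mem_undup mem_filter; split=> [/andP[/asboolP]//|Tt].
  by rewrite LE // andbT; apply/asboolP.
have [|||_ gL'] := @uniq_min_size _ (map g L') L'.
- rewrite map_inj_in_uniq ?undup_uniq // => s t /memL' Ts /memL' Tt gst.
  by apply: f_inj; case: (gE s Ts) => _ <-; case: (gE t Tt) => _ <-; rewrite gst.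
- by move=> _ /mapP[t /memL' Tt ->]; apply/memL'; case: (gE t Tt).
- by rewrite size_map.
have preim z : p_torsion p z -> z \in N -> z = g 0.
  move=> /memL'; rewrite -gL' => /mapP[t /memL' Tt ->] Nz.
  congr g; apply: f0; case: (gE t Tt) => _ <-; exact/qE.
case/eqP: y_neq0; rewrite (preim y) -?(preim 0) ?rpred0 //.
  by exists 0%N; rewrite mul0rn.
by exists 1%N.
Qed.

(** * Splitting off almost all of a bounded primary component *)

(** Applied to all elements of [B], this says that [B] is an injective module
    over the integers modulo [q] (Baer's criterion), that is, a direct sum of
    cyclic groups of order [q] when [q] is a prime power. *)
Definition mod_injective (G : zmodType) (q : nat) (B : G -> Prop) (x : G) : Prop :=
  x *+ q = 0 /\
  forall m n, (m * n = q)%N -> x *+ m = 0 -> exists2 y, B y & y *+ n = x.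

(** The projection onto [B] along [W] is defined on [B + W], and it extends to
    [G] because [B] is injective modulo [q] and [W] contains all multiples of
    [q]. *)
Lemma mod_injective_retraction (G : zmodType) (q : nat) (B W : G -> Prop) :
  (0 < q)%N -> is_subgroup B -> is_subgroup W ->
  (forall x, B x -> mod_injective q B x) ->
  (forall x, B x -> W x -> x = 0) -> (forall g, W (g *+ q)) ->
  exists rho : {additive G -> G},
    [/\ forall g, B (rho g), forall x, B x -> rho x = x
      & forall x, W x -> rho x = 0].
Proof.
move=> q_gt0 subB subW injB BW Wq.
have [A AE] := zmodClosed_of_is_subgroup subB.
have valB (b : subgroup A) : B (val b) by apply/AE; exact: valP.
have valMn (b : subgroup A) n : val (b *+ n) = val b *+ n by rewrite raddfMn.
have [|||r rE] := @Baer_extension G (subgroup A)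
    (fun x => exists2 w, W w & x.1 = val x.2 + w).
- split=> /=; first by exists 0; [exact: subW.1|rewrite addr0].
  move=> [x b] [y c] [v Wv /= ->] [w Ww /= ->]; exists (v - w); first exact: subW.2.
  by rewrite /= opprD addrACA.
- move=> d [w Ww /= /esym/eqP]; rewrite addr_eq0 => /eqP dw.
  apply/val_inj; rewrite raddf0; apply: BW; first exact: valB.
  by have -> : val d = - w := dw; exact: is_subgroupN.
- move=> g n d n_gt0 dW; pose c := gcdn n q.
  have c_gt0 : (0 < c)%N by rewrite gcdn_gt0 n_gt0.
  have qE : (q %/ c * c = q)%N by rewrite divnK // dvdn_gcdr.
  (* [q %/ c] is the least [m] such that [q] divides [n * m]. *)
  have dm : val d *+ (q %/ c) = 0.
    rewrite -valMn dW ?raddf0 //; exists (g *+ (n * (q %/ c)));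
      last exact: (esym (add0r _)).
    by rewrite muln_divCA_gcd mulrnA -mulrnA mulnC mulrnA; exact: Wq.
  have [_ /(_ _ _ qE dm)[y By yE]] := injB _ (valB d).
  have [v vE] := Bezout_mulrn n_gt0 (proj1 (injB _ By)).
  have Ayv : y *+ v \in A by apply/AE; exact: is_subgroupMn.
  by exists (Sub (y *+ v) Ayv); apply/val_inj; rewrite valMn SubK vE.
have [rho rhoE] := @additive_of_morphism G G (fun g => val (r g))
  (fun x y => etrans (congr1 val (raddfB r x y)) (raddfB _ _ _)).
exists rho; split=> [g|x Bx|x Wx]; rewrite rhoE.
- exact: valB.
- have Ax : x \in A by apply/AE.
  rewrite (rE x (Sub x Ax)) ?SubK //; exists 0; first exact: subW.1.
  by rewrite /= addr0.
- by rewrite (rE x 0) ?raddf0 //; exists x => //; exact: (esym (add0r _)).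
Qed.

Definition retracts_to_p_torsion (G : zmodType) (p : nat) (l : seq G)
    (rho : {additive G -> G}) : Prop :=
  [/\ forall g, rho (rho g) = rho g, forall g, p_torsion p (rho g)
    & forall y, y \in l -> rho y = 0].

Definition finite_residual (G : zmodType) (p k : nat)
    (rho : {additive G -> G}) : Prop :=
  exists L : seq G, forall x, p_torsion p x -> rho x = 0 -> x *+ (p ^ k) \in L.

Lemma finite_residual_reps (G : zmodType) (K : G -> Prop) (q : nat) (L : seq G) :
  (forall x, K x -> x *+ q \in L) ->
  exists2 E : seq G, forall e, e \in E -> K e &
    forall x, K x -> exists2 e, e \in E & e *+ q = x *+ q.
Proof.
move=> KL.
have /choice[c cE] : forall y, exists e,
    (exists2 x, K x & x *+ q = y) -> K e /\ e *+ q = y.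
  move=> y; have [[x Kx xq]|no] := pselect (exists2 x, K x & x *+ q = y).
    by exists x.
  by exists 0.
exists [seq c y | y <- L & `[< exists2 x, K x & x *+ q = y >]].
  by move=> e /mapP[y]; rewrite mem_filter => /andP[/asboolP/cE[Kc _] _] ->.
move=> x Kx; exists (c (x *+ q)); last first.
  by have [|_ ->] := cE (x *+ q); first by exists x.
apply/mapP; exists (x *+ q) => //; rewrite mem_filter KL // andbT.
by apply/asboolP; exists x.
Qed.

(** Write [q] for [p ^ k].  Subtracting its image under [rho] from
    [x = f + g *+ q + rho g'] turns [x] into the sum of a residue of [f] and of
    [q] times an element of the kernel of [rho].  For two such torsion elements
    with the same residue, the difference is [q] times an element of the kernel
    that is itself [p]-torsion, so it belongs to a finite set. *)
Lemma finite_torsion_residues (G : zmodType) (p k : nat) (l : seq G)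
    (rho : {additive G -> G}) :
  prime p -> retracts_to_p_torsion p l rho -> finite_residual p k rho ->
  exists L : seq G, forall x, p_torsion p x -> rho x = 0 ->
    (exists f g g', zspan l f /\ x = f + g *+ (p ^ k) + rho g') -> x \in L.
Proof.
move=> p_pr [rho_idem _ rhol] [L LE]; pose q := (p ^ k)%N.
have subT := p_torsion_subgroup G p.
have q_gt0 : (0 < q)%N by rewrite expn_gt0 prime_gt0.
pose C r x := [/\ p_torsion p x, rho x = 0 & exists2 u, rho u = 0 & x = r + u *+ q].
have /choice[c cE] : forall r, exists t, (exists x, C r x) -> C r t.
  move=> r; have [[x Cx]|no] := pselect (exists x, C r x); first by exists x.
  by exists 0.
exists [seq c r + y | r <- residues q l, y <- L] => x Tx rx [f [g [g' [spf xE]]]].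
have [r rl [w spw fE]] := residuesP q_gt0 spf.
have rho_span v : zspan l v -> rho v = 0.
  apply: (@zspan_min _ (fun v => rho v = 0)) => //.
  by split=> [|a b a0 b0]; rewrite ?raddf0 // raddfB a0 b0 subr0.
have Cx : C r x.
  split=> //; exists (g + w - rho (g + w)); first by rewrite raddfB rho_idem subrr.
  have rhor : rho r = 0.
    by rewrite -(addrK (w *+ q) r) -fE raddfB raddfMn !rho_span ?mul0rn ?subr0.
  have xE' : x = r + (g + w) *+ q + rho g'.
    by rewrite xE fE -[_ + w *+ q + _]addrA -mulrnDl [w + g]addrC.
  move: rx; rewrite {1}xE' !(raddfD rho) rhor add0r raddfMn rho_idem.
  move/eqP; rewrite addrC addr_eq0 => /eqP rg'.
  by rewrite {1}xE' rg' mulrnBl addrA raddfD.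
have [Tc rc [u' ru' cxE]] := cE r (ex_intro _ x Cx).
case: Cx => _ _ [u ru uE].
apply/allpairsP; exists (r, x - c r); split=> //=; last by rewrite addrC subrK.
have xc : x - c r = (u - u') *+ q.
  by rewrite cxE {1}uE opprD addrACA subrr add0r mulrnBl.
rewrite xc; apply: LE; last by rewrite raddfB ru ru' subr0.
have [j] := subT.2 _ _ Tx Tc; rewrite xc -mulrnA -expnD.
by exists (k + j)%N.
Qed.

(** Let [q = p ^ k.+1], and let [W] be generated by [q G], the image of [rho],
    the list [l] and finitely many elements [E] accounting for the values of
    [x *+ q] on the [p]-torsion elements [x] in the kernel of [rho].  Project
    onto a maximal [Z/q]-injective subgroup [B] that meets [W] trivially.  If
    [y *+ q = 0] and the projection kills [y], then [y *+ (p ^ k)] is in [W],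
    since otherwise [B] could be enlarged by [y].  A remaining [x] differs from
    an element of [E] by such a [y], so [x *+ (p ^ k)] is in [W], and
    [finite_torsion_residues] bounds the number of its values. *)
Lemma finite_residual_step (G : zmodType) (p k : nat) (l : seq G)
    (rho : {additive G -> G}) :
  prime p -> retracts_to_p_torsion p l rho -> finite_residual p k.+1 rho ->
  exists rho' : {additive G -> G},
    retracts_to_p_torsion p l rho' /\ finite_residual p k rho'.
Proof.
move=> p_pr [rho_idem rho_tors rhol] [L LE]; pose q := (p ^ k.+1)%N.
have subT := p_torsion_subgroup G p.
have q_gt0 : (0 < q)%N by rewrite expn_gt0 prime_gt0.
pose K x := p_torsion p x /\ rho x = 0.
have [|E EK EE] := @finite_residual_reps G K q L; first by move=> x [Tx rx]; exact: LE.
pose W x := exists f g g', zspan (E ++ l) f /\ x = f + g *+ q + rho g'.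
have subW : is_subgroup W.
  split.
    exists 0, 0, 0; split; first by case: (zspan_subgroup (E ++ l)).
    by rewrite raddf0 mul0rn !addr0.
  move=> _ _ [f [g [g' [spf ->]]]] [h [j [j' [sph ->]]]].
  exists (f - h), (g - j), (g' - j'); split; first exact: (zspan_subgroup _).2.
  by rewrite mulrnBl raddfB !opprD addrACA; congr (_ + _); rewrite addrACA.
have Wq g : W (g *+ q).
  exists 0, g, 0; split; first by case: (zspan_subgroup (E ++ l)).
  by rewrite raddf0 add0r addr0.
have Wrho g : W (rho g).
  exists 0, 0, g; split; first by case: (zspan_subgroup (E ++ l)).
  by rewrite mul0rn !add0r.
have Wspan f : zspan (E ++ l) f -> W f.
  by move=> spf; exists f, 0, 0; split=> //; rewrite raddf0 mul0rn !addr0.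
have trivial_sub : is_subgroup (fun x : G => x = 0).
  by split=> // x x' -> ->; rewrite subr0.
have [|||B [subB QB _ maxB]] := @maximal_subgroup G
    (fun B x => mod_injective q B x /\ (W x -> x = 0)) (fun x => x = 0).
- move=> A B x AB [[xq injx] Wx]; split=> //; split=> // m n mn xm.
  by have [y /AB By yE] := injx m n mn xm; exists y.
- exact: trivial_sub.
- move=> _ ->; split=> //; split=> [|m n _ _]; first by rewrite mul0rn.
  by exists 0; rewrite ?mul0rn.
have [|||rho1 [rho1B rho1_id rho1W]] := mod_injective_retraction q_gt0 subB subW.
- by move=> x /QB[].
- by move=> x /QB[].
- exact: Wq.
(* The correction by [rho] makes the images of the two retractions independent,
   so that the sum is again idempotent. *)
have [|rho' rho'E] := @additive_of_morphism G G
    (fun g => rho g + (rho1 g - rho (rho1 g))).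
  move=> x y; rewrite !(raddfB rho, raddfB rho1) [in RHS]opprD [in RHS]addrACA.
  congr (_ + _).
  by rewrite !opprB addrACA [in RHS]addrACA; congr (_ + _); rewrite addrC.
have rho1_idem g : rho1 (rho1 g) = rho1 g by exact: rho1_id.
have rho1rho g : rho1 (rho g) = 0 by exact: rho1W.
have rho_rho' g : rho (rho' g) = rho g.
  by rewrite rho'E raddfD raddfB !rho_idem subrr addr0.
have rho1_rho' g : rho1 (rho' g) = rho1 g.
  by rewrite rho'E raddfD raddfB !rho1rho rho1_idem subr0 add0r.
have Tq x : x *+ q = 0 -> p_torsion p x by exists k.+1.
have killed y : y \in E ++ l -> rho y = 0 /\ rho1 y = 0.
  move=> yEl; split; last by apply/rho1W/Wspan/mem_zspan.
  by move: yEl; rewrite mem_cat => /orP[/EK[]|/rhol].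
have retr' : retracts_to_p_torsion p l rho'.
  split=> [g|g|y yl].
  - by rewrite [LHS]rho'E rho_rho' rho1_rho' -rho'E.
  - rewrite rho'E; apply: (is_subgroupD subT) => //; apply: subT.2 => //.
    by apply: Tq; case: (QB _ (rho1B g)) => -[].
  - have [|r0 r10] := killed y; first by rewrite mem_cat yl orbT.
    by rewrite rho'E r0 r10 raddf0 subr0 addr0.
exists rho'; split=> //.
have [||L' L'E] := @finite_torsion_residues G p k.+1 (E ++ l) rho p_pr.
- by split=> // y /killed[].
- by exists L.
exists L' => x Tx r'x.
have rx : rho x = 0 by rewrite -rho_rho' r'x raddf0.
have r1x : rho1 x = 0 by rewrite -rho1_rho' r'x raddf0.
apply: L'E; [exact: is_subgroupMn|by rewrite raddfMn rx mul0rn|].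
have [e eE eq] := EE x (conj Tx rx).
have [re r1e] : rho e = 0 /\ rho1 e = 0 by apply: killed; rewrite mem_cat eE.
pose y := x - e.
have yq : y *+ q = 0 by rewrite mulrnBl eq subrr.
have r1y : rho1 y = 0 by rewrite raddfB r1x r1e subrr.
suff Wy : W (y *+ (p ^ k)).
  rewrite -/(W _) -[x](subrK e) mulrnDl; apply: (is_subgroupD subW) => //.
  apply: (is_subgroupMn subW); apply: Wspan; apply: mem_zspan.
  by rewrite mem_cat eE.
apply: contrapT => nWy.
(* The subgroup generated by [B] and [y] contradicts the maximality of [B]. *)
have subBy : is_subgroup (fun x => exists2 b, B b & exists z : int, x = b + y *~ z).
  split; first by exists 0; [exact: subB.1|exists 0; rewrite mulr0z addr0].
  move=> _ _ [b Bb [z ->]] [c Bc [t ->]]; exists (b - c); first exact: subB.2.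
  by exists (z - t); rewrite mulrzBr opprD addrACA.
have rho1By b z : B b -> rho1 (b + y *~ z) = b.
  by move=> Bb; rewrite raddfD raddfMz r1y mul0rz addr0; exact: rho1_id.
have By : B y.
  apply: (maxB _ subBy) => [_ [b Bb [z ->]]|b Bb|].
  - split; last first.
      move=> Wbyz; have b0 : b = 0 by rewrite -(rho1By b z Bb); exact: rho1W.
      move: Wbyz; rewrite b0 add0r => Wyz.
      have [|c ->] := subgroup_prime_power p_pr subW _ Wyz nWy.
        by rewrite yq; exact: subW.1.
      by rewrite mulrzA -pmulrn yq mul0rz.
    have [[bq injb] _] := QB b Bb; split.
      by rewrite mulrnDl bq add0r pmulrn mulrzAC -pmulrn yq mul0rz.
    move=> m n mn bym.
    have bm : b *+ m = 0 by rewrite -(rho1By b z Bb) -raddfMn bym raddf0.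
    have [b' Bb' b'E] := injb m n mn bm.
    have yzm : y *~ (z * m%:Z) = 0.
      by move: bym; rewrite mulrnDl bm add0r mulrzA -pmulrn.
    have [|c zmE] := subgroup_prime_power p_pr trivial_sub yq yzm.
      by move=> y0; apply: nWy; rewrite y0; exact: subW.1.
    exists (b' + y *~ c); first by exists b' => //; exists c.
    rewrite mulrnDl b'E; congr (_ + _).
    suff -> : z = c * n%:Z by rewrite mulrzA -pmulrn.
    have m_neq0 : m%:Z != 0.
      by rewrite -lt0n; move: q_gt0; rewrite -mn muln_gt0 => /andP[].
    by apply: (mulIf m_neq0); rewrite zmE -/q -mn PoszM mulrC mulrAC mulrA.
  - by exists b => //; exists 0; rewrite mulr0z addr0.
  - by exists 0; [exact: subB.1|exists 1; rewrite mulr1z add0r].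
by apply: nWy; rewrite -(rho1_id y By) r1y mul0rn; exact: subW.1.
Qed.

Lemma cofinite_retraction (G : zmodType) (p : nat) (l : seq G) :
  prime p -> bounded_p_torsion G ->
  exists2 rho : {additive G -> G}, retracts_to_p_torsion p l rho &
    exists L : seq G, forall x, p_torsion p x -> rho x = 0 -> x \in L.
Proof.
move=> p_pr bG; have [n nE] := bG p p_pr.
have [rho0 rho0E] := @additive_of_morphism G G
  (fun=> 0) (fun _ _ => esym (subr0 0)).
suff [rho [retr [L LE]]] : exists rho : {additive G -> G},
    retracts_to_p_torsion p l rho /\ finite_residual p 0 rho.
  by exists rho => //; exists L => x Tx rx; have := LE x Tx rx; rewrite mulr1n.
have : exists rho : {additive G -> G},
    retracts_to_p_torsion p l rho /\ finite_residual p n rho.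
  exists rho0; split; last first.
    by exists [:: 0] => x /(p_torsionP _ p_pr)/nE -> _; rewrite inE.
  by split=> *; rewrite !rho0E //; exists 0%N; rewrite mul0rn.
elim: n {nE} => // k IH [rho [retr fin]]; apply: IH.
exact: finite_residual_step fin.
Qed.

(** * Assembling the primes *)

Lemma in_torsion_subgroup (G : zmodType) : is_subgroup (@in_torsion G).
Proof.
split=> [|x y [m m_gt0 xm] [n n_gt0 yn]]; first by exists 1%N; rewrite ?mul0rn.
exists (m * n)%N; first by rewrite muln_gt0 m_gt0.
by rewrite mulrnBl mulrnA xm mulnC mulrnA yn !mul0rn subrr.
Qed.

Lemma coprime_mulrn_eq0 (G : zmodType) (x : G) m n :
  (0 < m)%N -> coprime m n -> x *+ m = 0 -> x *+ n = 0 -> x = 0.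
Proof.
move=> m_gt0 /eqP mn xm xn; have [v] := Bezout_mulrn m_gt0 xn.
by rewrite mn mulr1n mulrnAC xm mul0rn.
Qed.

Lemma p_torsion_neq (G : zmodType) (p q : nat) (x : G) :
  prime p -> prime q -> p != q -> p_torsion p x -> p_torsion q x -> x = 0.
Proof.
move=> p_pr q_pr pq [j xj] [k xk]; apply: coprime_mulrn_eq0 xj xk.
  by rewrite expn_gt0 prime_gt0.
by rewrite coprimeXl // coprimeXr // prime_coprime // dvdn_prime2.
Qed.

Lemma subgroup_valE (G : zmodType) (A : zmodClosed G) :
  exists2 f : {additive subgroup A -> G}, f =1 val & injective f.
Proof.
have [f fE] := @additive_of_morphism (subgroup A) G val (raddfB _).
by exists f => // x y; rewrite !fE => /val_inj.
Qed.

(** A multiple of a given element lies in the span of [l], on which all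
    retractions vanish.  Hence the retractions take torsion values on it, killed
    by a common integer, so they vanish for the primes that do not divide this
    integer.  The sum of all retractions is thus a well-defined projection, with
    image [S] and kernel [H]. *)
Lemma split_retractions (G : zmodType) (l : seq G)
    (rho : nat -> {additive G -> G}) :
  (forall g, exists2 n, (0 < n)%N & zspan l (g *+ n)) ->
  (forall p, prime p -> retracts_to_p_torsion p l (rho p)) ->
  exists H S : zmodClosed G,
    [/\ internal_direct_sum H S,
        forall x p, x \in H -> prime p -> rho p x = 0
      & forall x, x \in S -> in_torsion x].
Proof.
move=> maxl retr.
have vanish g : exists N, forall p, prime p -> (N <= p)%N -> rho p g = 0.
  have [n n_gt0 spn] := maxl g; exists n.+1 => p p_pr n_lt_p.
  have [_ tors rhol] := retr p p_pr; have [k gk] := tors g.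
  apply: (coprime_mulrn_eq0 n_gt0 _ _ gk).
    rewrite coprimeXr // coprime_sym prime_coprime //.
    by apply/negP => /(dvdn_leq n_gt0); rewrite leqNgt n_lt_p.
  rewrite -raddfMn; apply: (@zspan_min _ (fun v => rho p v = 0)) spn => //.
  by split=> [|a b a0 b0]; rewrite ?raddf0 // raddfB a0 b0 subr0.
have orth p q g : prime p -> prime q -> p != q -> rho p (rho q g) = 0.
  move=> p_pr q_pr pq; apply: (p_torsion_neq p_pr q_pr pq).
    by case: (retr p p_pr).
  have [_ /(_ g)[k gk] _] := retr q q_pr.
  by exists k; rewrite -raddfMn gk raddf0.
pose s M g := \sum_(0 <= p < M | prime p) rho p g.
have s_stable g N M : (forall p, prime p -> (N <= p)%N -> rho p g = 0) ->
    (N <= M)%N -> s M g = s N g.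
  move=> gN NM; rewrite /s (big_cat_nat (leq0n N) NM) /= -[RHS]addr0.
  congr (_ + _); rewrite big_nat_cond big1 // => p /andP[/andP[Np _] p_pr].
  exact: gN.
have rho_s g N p : (forall p, prime p -> (N <= p)%N -> rho p g = 0) ->
    prime p -> rho p (s N g) = rho p g.
  move=> gN p_pr; rewrite -(s_stable g N (maxn N p.+1)) ?leq_maxl //.
  rewrite raddf_sum big_mkcond (bigD1_seq p) ?iota_uniq //=; last first.
    by rewrite mem_index_iota leq_maxr.
  have [-> _ _] := retr p p_pr; rewrite p_pr big1 ?addr0 // => q qp.
  by case: ifP => // q_pr; apply: orth; rewrite // eq_sym.
have [|H HE] := @zmodClosed_of_is_subgroup G
    (fun x => forall p, prime p -> rho p x = 0).
  by split=> [p _|x y x0 y0 p p_pr]; rewrite ?raddf0 // raddfB x0 ?y0 ?subr0.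
have [|S SE] := @zmodClosed_of_is_subgroup G
    (fun x => exists N, forall M, (N <= M)%N -> x = s M x).
  split=> [|x y [N xN] [N' yN']].
    by exists 0%N => M _; rewrite /s big1 // => p _; rewrite raddf0.
  exists (maxn N N') => M; rewrite geq_max => /andP[NM N'M].
  rewrite {1}(xN M NM) {1}(yN' M N'M) /s -sumrB.
  by apply: eq_bigr => p _; rewrite raddfB.
exists H, S; split; [split| |].
- move=> g; have [N gN] := vanish g; exists (g - s N g).
    by apply/HE => p p_pr; rewrite raddfB rho_s ?subrr.
  exists (s N g); last by rewrite subrK.
  apply/SE; exists N => M NM; rewrite -{1}(s_stable g N M gN NM) /s.
  by apply: eq_bigr => p p_pr; rewrite rho_s.
- move=> x /HE rho_x0 /SE[N /(_ N (leqnn N)) ->].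
  by rewrite /s big1 // => p p_pr; exact: rho_x0.
- by move=> x p /HE; exact.
- move=> x /SE[N /(_ N (leqnn N)) ->]; rewrite /s; have subT := in_torsion_subgroup G.
  apply: big_ind => [|a b|p p_pr]; [exact: subT.1|exact: is_subgroupD|].
  by have [_ tors _] := retr p p_pr; case/(p_torsionP _ p_pr): (tors x).
Qed.

(** [H] is Bassian because it inherits finite rank from [G], and its primary
    components are the finite kernels of the retractions. *)
Lemma splitting_of_finite_rank (G : zmodType) :
  finite_torsion_free_rank G -> bounded_p_torsion G ->
  exists H S : zmodClosed G,
    [/\ internal_direct_sum H S, Bassian (subgroup H),
        torsion_group (subgroup S) & bounded_p_torsion (subgroup S)].
Proof.
move=> rankG bG; have [l [_ maxl]] := rational_basis_exists rankG.
have /choice[rho rhoE] : forall p, exists rho : {additive G -> G}, prime p ->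
    retracts_to_p_torsion p l rho /\
    exists L : seq G, forall x, p_torsion p x -> rho x = 0 -> x \in L.
  move=> p; have [p_pr|np] := boolP (prime p).
    by have [rho retr fin] := cofinite_retraction l p_pr bG; exists rho.
  by exists idfun.
have [|H [S [HS Hrho Stors]]] := @split_retractions G l rho maxl.
  by move=> p /rhoE[].
exists H, S; split=> //.
- have [f fE f_inj] := subgroup_valE H.
  have [n bound] := indep_size_bounded rankG.
  apply: (@Bassian_of_finite _ n) => [m indm|p p_pr].
    rewrite -(size_map f); apply/bound/indep_map => // x.
    by rewrite -(raddf0 f) => /f_inj ->; exists 1%N; rewrite ?mul0rn.
  have [_ [L LE]] := rhoE p p_pr; exists (pmap insub L) => x [k xk].
  rewrite mem_pmap_sub; apply: LE; last exact: Hrho (valP x) p_pr.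
  by exists k; rewrite -fE -raddfMn xk raddf0.
- move=> x; have [n n_gt0 xn] := Stors (val x) (valP x); exists n => //.
  by apply/val_inj; rewrite raddfMn xn raddf0.
- move=> p p_pr; have [n nE] := bG p p_pr; exists n => x /(p_torsionP _ p_pr)[k xk].
  apply/val_inj; rewrite raddfMn nE ?raddf0 //; apply/(p_torsionP _ p_pr); exists k.
  by rewrite -raddfMn xk raddf0.
Qed.

Lemma finite_rank_of_splitting (G : zmodType) (H S : zmodClosed G) :
  internal_direct_sum H S -> Bassian (subgroup H) -> torsion_group (subgroup S) ->
  finite_torsion_free_rank G.
Proof.
move=> [GE _] BH torS; have [l [indl maxl]] := Bassian_rational_basis BH.
have [f fE f_inj] := subgroup_valE H.
apply: (@finite_rank_of_basis G (map f l)); split.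
  apply: indep_map indl => x; rewrite -(raddf0 f) => /f_inj ->.
  by exists 1%N; rewrite ?mul0rn.
move=> g; have [a Ha [b Sb ->]] := GE g.
have [n n_gt0 spn] := maxl (Sub a Ha); have [h hE _] := subgroup_valE S.
have [m m_gt0 bm] := torS (Sub b Sb).
have {}bm : b *+ m = 0.
  by move/(congr1 h): bm; rewrite raddfMn raddf0 hE SubK.
exists (n * m)%N; first by rewrite muln_gt0 n_gt0.
have -> : (a + b) *+ (n * m) = f (Sub a Ha *+ n) *+ m.
  rewrite mulrnDl mulnC [b *+ _]mulrnA bm mul0rn addr0.
  by rewrite raddfMn fE SubK mulnC mulrnA.
apply: (is_subgroupMn (zspan_subgroup _)); apply/zspan_map.
by exists (Sub a Ha *+ n).
Qed.

Lemma bounded_p_torsion_sum (G : zmodType) (H S : zmodClosed G) :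
  internal_direct_sum H S -> bounded_p_torsion (subgroup H) ->
  bounded_p_torsion (subgroup S) -> bounded_p_torsion G.
Proof.
move=> [GE HS] bH bS p p_pr.
have [m mE] := bH p p_pr; have [n nE] := bS p p_pr.
have bounded (A : zmodClosed G) k : (forall x : subgroup A,
    in_primary_torsion p x -> x *+ (p ^ k) = 0) ->
    forall a, a \in A -> p_torsion p a -> a *+ (p ^ k) = 0.
  move=> kE a Aa [j aj]; have [f fE f_inj] := subgroup_valE A.
  have : (Sub a Aa : subgroup A) *+ (p ^ k) = 0.
    apply/kE/(p_torsionP _ p_pr); exists j; apply: f_inj.
    by rewrite (raddf0 f) raddfMn fE SubK aj.
  by move/(congr1 f); rewrite (raddf0 f) raddfMn fE SubK.
exists (m + n)%N => x /(p_torsionP _ p_pr)[k xk].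
have [a Ha [b Sb xE]] := GE x.
have /eqP : a *+ (p ^ k) + b *+ (p ^ k) = 0 by rewrite -mulrnDl -xE.
rewrite addr_eq0 => /eqP ab.
have ak : a *+ (p ^ k) = 0.
  by apply: HS; [exact: rpredMn|rewrite ab rpredN; exact: rpredMn].
have bk : b *+ (p ^ k) = 0.
  by move: ab; rewrite ak => /esym/eqP; rewrite oppr_eq0 => /eqP.
rewrite xE mulrnDl expnD [in b *+ _]mulnC !mulrnA.
rewrite (bounded H m mE a Ha) ?(bounded S n nE b Sb) ?mul0rn ?addr0 //.
  by exists k.
by exists k.
Qed.

Theorem theorem3p1 (G : zmodType) :
  finite_torsion_free_rank G /\ bounded_p_torsion G <->
  exists H S : zmodClosed G,
    [/\ internal_direct_sum H S,
        Bassian (subgroup H),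
        torsion_group (subgroup S)
      & bounded_p_torsion (subgroup S)].
Proof.
split=> [[rankG bG]|[H [S [HS BH torS bS]]]].
  exact: splitting_of_finite_rank.
split; first exact: finite_rank_of_splitting HS BH torS.
exact: bounded_p_torsion_sum HS (Bassian_bounded BH) bS.
Qed.
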